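(* Let $G$ be a Lie group and let $E=E(g,\mu,\xi,\nu)$ be a smooth function on $TT^*G\simeq(G\circledS\mathfrak g^* )\circledS(\mathfrak g\circledS\mathfrak g^* )$ with the Tulczyjew symplectic form $\Omega_{TT^*G}$. Hamilton's equation $i_{X_E}\Omega_{TT^*G}=-dE$ defines a Hamiltonian right invariant vector field $X_E$ generated by the element $$\Big(\frac{\delta E}{\delta\nu},\ -\Big(\frac{\delta E}{\delta\xi}+\mathrm{ad}^*_{\frac{\delta E}{\delta\nu}}\mu\Big),\ \frac{\delta E}{\delta\mu}+\mathrm{ad}_\xi\frac{\delta E}{\delta\nu},\ -\Big(T_e^*R_g\frac{\delta E}{\delta g}+\mathrm{ad}^*_\xi\frac{\delta E}{\delta\xi}+\mathrm{ad}^*_\xi\mathrm{ad}^*_{\frac{\delta E}{\delta\nu}}\mu\Big)\Big)$$ of the Lie algebra $(\mathfrak g\circledS\mathfrak g^* )\circledS(\mathfrak g\circledS\mathfrak g^* )$. Components of $X_E$ define Hamilton's equations $$\dot g=T_eR_g\Big(\frac{\delta E}{\delta\nu}\Big),\qquad\dot\mu=-\frac{\delta E}{\delta\xi},\qquad\dot\xi=\frac{\delta E}{\delta\mu},\qquad\dot\nu=\mathrm{ad}^*_{\frac{\delta E}{\delta\nu}}\nu-T_e^*R_g\Big(\frac{\delta E}{\delta g}\Big).$$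
   Context: $G$ is a (finite-dimensional) Lie group with identity $e$, $\mathfrak g=T_eG$, dual $\mathfrak g^*$. $R_g$ is right multiplication, $T_e^*R_g:T_g^*G\to\mathfrak g^*$ the dual of $T_eR_g$. $\mathrm{Ad}_g=T_e(h\mapsto ghg^{-1})$, $\mathrm{ad}_\xi\eta=[\xi,\eta]=\frac{d}{dt}|_{t=0}\mathrm{Ad}_{\exp t\xi}\eta$, $\langle\mathrm{Ad}^*_g\mu,\xi\rangle=\langle\mu,\mathrm{Ad}_{g^{-1}}\xi\rangle$, $\langle\mathrm{ad}^*_\xi\mu,\eta\rangle=-\langle\mu,[\xi,\eta]\rangle$. $T^*G$ is identified with $G\circledS\mathfrak g^*$ by $\alpha_g\mapsto(g,T_e^*R_g\alpha_g)$, with group law $(g,\mu)(h,\nu)=(gh,\mu+\mathrm{Ad}^*_g\nu)$. $TT^*G=T(G\circledS\mathfrak g^* )$ is identified with $G\times\mathfrak g^*\times\mathfrak g\times\mathfrak g^*$ by sending $(V_g,V_\mu)\in T_{(g,\mu)}(G\circledS\mathfrak g^* )$ to $(g,\mu,\xi,\nu)$ with $\xi=T_gR_{g^{-1}}V_g$, $\nu=V_\mu-\mathrm{ad}^*_\xi\mu$. The group law is $(g,\mu_1,\xi,\mu_2)(h,\nu_1,\eta,\nu_2)=(gh,\mu_1+\mathrm{Ad}^*_g\nu_1,\xi+\mathrm{Ad}_g\eta,\mu_2+\mathrm{Ad}^*_g\nu_2-\mathrm{ad}^*_{\mathrm{Ad}_g\eta}\mu_1)$; the right invariant vector field generated by $(\eta_1,\nu_1,\eta_2,\nu_2)$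 has at $(g,\mu,\xi,\nu)$ the value $(T_eR_g\eta_1,\ \nu_1+\mathrm{ad}^*_{\eta_1}\mu,\ \eta_2+[\eta_1,\xi],\ \nu_2+\mathrm{ad}^*_{\eta_1}\nu-\mathrm{ad}^*_\xi\nu_1)$, and ''generated by'' a point-dependent element means this expression evaluated at the point. $\Omega_{TT^*G}$ is Tulczyjew's symplectic form, i.e. the tangent (complete) lift to $TT^*G$ of the canonical symplectic form $d\theta$ of $T^*G$ ($\theta$ the Liouville form), transported by the trivialization. Explicitly, at $(g,\mu,\xi,\nu)$, for tangent vectors $(T_eR_ga,\delta\mu,\delta\xi,\delta\nu)$ and $(T_eR_g\bar a,\delta\bar\mu,\delta\bar\xi,\delta\bar\nu)$ with $a,\bar a\in\mathfrak g$, its value is $\langle\delta\nu,\bar a\rangle-\langle\delta\bar\nu,a\rangle+\langle\nu,[a,\bar a]\rangle+\langle\delta\mu,\delta\bar\xi\rangle-\langle\delta\bar\mu,\delta\xi\rangle$. $\frac{\delta E}{\delta g}\in T_g^*G$, $\frac{\delta E}{\delta\mu},\frac{\delta E}{\delta\nu}\in\mathfrak g$, $\frac{\delta E}{\delta\xi}\in\mathfrak g^*$ are partial derivatives. *)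

(* Defs.v *)
From HB Require Import structures.
From mathcomp Require Import all_boot all_order all_algebra.
From mathcomp Require Import all_classical all_reals all_analysis.

Set Implicit Arguments.
Unset Strict Implicit.
Unset Printing Implicit Defensive.

Import Order.TTheory GRing.Theory Num.Theory.
Import numFieldNormedType.Exports.

Local Open Scope classical_set_scope.
Local Open Scope ring_scope.

(* All model spaces of manifolds used below are finite dimensional: 'rV[R]_n,
   'cV[R]_n, R^o and their binary products. *)

Section Manifolds.
Context {R : realType}.

(* In finite dimension a function is C^(k+1) on an open set U iff it is
   differentiable on U and its derivative in every fixed direction is C^k;
   Ck is only meant for open U. *)
Fixpoint Ck (k : nat) (E F : normedModType R) (U : set E) (f : E -> F) : Prop :=
  if k is k'.+1 then
    (forall x, U x -> differentiable f x) /\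
    (forall v : E, Ck k' U (fun x => 'd f x v))
  else forall x, U x -> {for x, continuous f}.

Definition smooth_on (E F : normedModType R) (U : set E) (f : E -> F) : Prop :=
  forall k, Ck k U f.

(* [coord] and [uncoord] are total functions: only their values on [dom] and on
   [coord @` dom] are meaningful. *)
Record chart (E : normedModType R) (M : topologicalType) := Chart {
  dom : set M;
  coord : M -> E;
  uncoord : E -> M;
  open_dom : open dom;
  open_coord : open (coord @` dom);
  coordK : forall x, dom x -> uncoord (coord x) = x;
  coord_continuous : forall x, dom x -> {for x, continuous coord};
  uncoord_continuous : forall x, dom x -> {for coord x, continuous uncoord}
}.

(* An atlas with a preferred chart around each point.  Every atlas contains
   such a family, and that family determines the same smooth structure. *)
Record atlas (E : normedModType R) (M : topologicalType) := Atlas {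
  chart_at :> M -> chart E M;
  mem_chart_at : forall x, dom (chart_at x) x
}.

Definition is_manifold (E : normedModType R) (M : topologicalType)
    (A : atlas E M) : Prop :=
  [/\ hausdorff_space M, @second_countable M &
      forall x y, smooth_on (coord (A x) @` (dom (A x) `&` dom (A y)))
                            (coord (A y) \o uncoord (A x))].

Program Definition id_chart (E : normedModType R) : chart E E :=
  @Chart E E setT id id _ _ _ _ _.
Next Obligation. by move=> E; exact: openT. Qed.
Next Obligation. by move=> E; rewrite image_id; exact: openT. Qed.
Next Obligation. by []. Qed.
Next Obligation. by move=> E x _; apply: cvg_id. Qed.
Next Obligation. by move=> E x _; apply: cvg_id. Qed.

Definition id_atlas (E : normedModType R) : atlas E E :=
  @Atlas E E (fun=> id_chart E) (fun=> I).

Lemma open_setX {M N : topologicalType} (A : set M) (B : set N) : open A -> open B -> open (A `*` B).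
Proof.
rewrite !openE => oA oB [x y] [/= Ax By].
by exists (A, B) => //=; split; [exact: oA | exact: oB].
Qed.

Section ProductChart.
Context {E F : normedModType R} {M N : topologicalType}.
Variables (c : chart E M) (d : chart F N).

Let pdom : set (M * N) := dom c `*` dom d.
Let pcoord (z : M * N) : E * F := (coord c z.1, coord d z.2).
Let puncoord (u : E * F) : M * N := (uncoord c u.1, uncoord d u.2).

Lemma prod_open_coord : open (pcoord @` pdom).
Proof.
have -> : pcoord @` pdom = (coord c @` dom c) `*` (coord d @` dom d).
  apply/seteqP; split=> [_ [[x y] [/= cx dy] <-]|[u v] [/= [x cx <-] [y dy <-]]].
    by split; [exists x | exists y].
  by exists (x, y).
by apply: open_setX; exact: open_coord.
Qed.

Lemma prod_coordK z : pdom z -> puncoord (pcoord z) = z.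
Proof. by case: z => x y [/= cx dy]; rewrite /puncoord /= !coordK. Qed.

Lemma prod_coord_continuous z : pdom z -> {for z, continuous pcoord}.
Proof.
case: z => x y [/= cx dy]; apply: (@cvg_pair _ _ _ _ (nbhs (coord c x))
  (nbhs (coord d y))).
- by apply: (cvg_comp _ _ (@cvg_fst _ _ (nbhs x) (nbhs y) _));
    exact: coord_continuous.
- by apply: (cvg_comp _ _ (@cvg_snd _ _ (nbhs x) (nbhs y) _));
    exact: coord_continuous.
Qed.

Lemma prod_uncoord_continuous z :
  pdom z -> {for pcoord z, continuous puncoord}.
Proof.
case: z => x y [/= cx dy]; apply: (@cvg_pair _ _ _ _
  (nbhs (uncoord c (coord c x))) (nbhs (uncoord d (coord d y)))).
- by apply: (cvg_comp _ _ (@cvg_fst _ _ (nbhs (coord c x))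
    (nbhs (coord d y)) _)); exact: uncoord_continuous.
- by apply: (cvg_comp _ _ (@cvg_snd _ _ (nbhs (coord c x))
    (nbhs (coord d y)) _)); exact: uncoord_continuous.
Qed.

Definition prod_chart : chart (E * F)%type (M * N)%type :=
  Chart (open_setX (open_dom c) (open_dom d)) prod_open_coord prod_coordK
        prod_coord_continuous prod_uncoord_continuous.

End ProductChart.

Definition prod_atlas {E F : normedModType R} {M N : topologicalType}
    (A : atlas E M) (B : atlas F N) : atlas (E * F)%type (M * N)%type :=
  @Atlas (E * F)%type (M * N)%type
    (fun z => prod_chart (A z.1) (B z.2))
    (fun z => conj (mem_chart_at A z.1) (mem_chart_at B z.2)).

(* The tangent space at x is the model space E: a tangent vector is given by its
   components in the preferred chart around x. *)
Definition tangent (E : normedModType R) (M : topologicalType)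
    (A : atlas E M) (x : M) : normedModType R := E.

Section Maps.
Context {E F : normedModType R} {M N : topologicalType}.
Variables (A : atlas E M) (B : atlas F N).

Definition smooth (f : M -> N) : Prop :=
  continuous f /\
  forall x y, smooth_on (coord (A x) @` (dom (A x) `&` f @^-1` dom (B y)))
                        (coord (B y) \o f \o uncoord (A x)).

Definition local_rep (f : M -> N) (x : M) : E -> F :=
  coord (B (f x)) \o f \o uncoord (A x).

Definition mdifferentiable (f : M -> N) (x : M) : Prop :=
  {for x, continuous f} /\ differentiable (local_rep f x) (coord (A x) x).

Definition tangent_map (f : M -> N) (x : M) : E -> F :=
  'd (local_rep f x) (coord (A x) x).

End Maps.

Definition smooth_vector_field (E : normedModType R) (M : topologicalType)
    (A : atlas E M) (X : forall x : M, tangent A x) : Prop :=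
  forall x0, smooth_on (coord (A x0) @` dom (A x0))
    (fun u => let y := uncoord (A x0) u in
       'd (coord (A x0) \o uncoord (A y)) (coord (A y) y) (X y)).

Definition has_velocity (E : normedModType R) (M : topologicalType)
    (A : atlas E M) (c : R^o -> M) (t : R) (v : E) : Prop :=
  mdifferentiable (id_atlas R^o) A c t /\
  tangent_map (id_atlas R^o) A c t 1 = v.

End Manifolds.

(* No compatibility between the two structures is required here; it comes from
   the smoothness conditions of lieGroup. *)
#[short(type="groupTopologicalType")]
HB.structure Definition GroupTopological := {G of Topological G & Group G}.

Record lieGroup (R : realType) (n : nat) := LieGroup {
  lie_sort :> groupTopologicalType;
  lie_atlas : atlas ('rV[R]_n) lie_sort;
  lie_manifold : is_manifold lie_atlas;
  lie_mul_smooth : smooth (prod_atlas lie_atlas lie_atlas) lie_atlas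
    (fun z : lie_sort * lie_sort => (z.1 * z.2)%g);
  lie_inv_smooth : smooth lie_atlas lie_atlas (fun g : lie_sort => g^-1%g)
}.

Section Lie.
Context {R : realType} {n : nat} (G : lieGroup R n).

(* T_gG is 'rV_n (row vectors) and T_g^*G is 'cV_n (column vectors). *)
Local Notation lie := 'rV[R]_n.
Local Notation dual := 'cV[R]_n.

Definition pairing (mu : dual) (xi : lie) : R := (xi *m mu) 0 0.

(* The element of 'cV_n (resp. 'rV_n) representing a linear form f. *)
Definition covector (f : lie -> R) : dual := \col_i f (delta_mx 0 i).
Definition vector_of (f : dual -> R) : lie := \row_i f (delta_mx i 0).

Definition Ad (g : G) : lie -> lie :=
  tangent_map (lie_atlas G) (lie_atlas G) (fun h : G => (g * h * g^-1)%g) 1%g.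

(* The derivative at e, in the direction xi, of g |-> Ad_g eta, i.e. the velocity
   at t = 0 of Ad_{c(t)} eta for any curve c with c(0) = e and c'(0) = xi, such
   as c(t) = exp(t xi). *)
Definition ad (xi eta : lie) : lie :=
  tangent_map (lie_atlas G) (id_atlas lie) (fun g : G => Ad g eta) 1%g xi.

Definition coad (xi : lie) (mu : dual) : dual :=
  covector (fun eta => - pairing mu (ad xi eta)).

(* T_e R_g : g -> T_gG and T_g R_{g^-1} : T_gG -> g *)
Definition TeR (g : G) : lie -> lie :=
  tangent_map (lie_atlas G) (lie_atlas G) (fun h : G => (h * g)%g) 1%g.
Definition TRV (g : G) : lie -> lie :=
  tangent_map (lie_atlas G) (lie_atlas G) (fun h : G => (h * g^-1)%g) g.

(* T_e^* R_g : T_g^*G -> g^* *)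
Definition coTeR (g : G) (alpha : dual) : dual :=
  covector (fun xi => pairing alpha (TeR g xi)).

(* TT^*G in the right trivialization; a point is ((g, mu), (xi, nu)). *)
Definition TTG : topologicalType := ((G * dual) * (lie * dual))%type.

Definition tt_model : normedModType R := ((lie * dual) * (lie * dual))%type.

Definition tt_atlas : atlas tt_model TTG :=
  prod_atlas (prod_atlas (lie_atlas G) (id_atlas dual))
             (prod_atlas (id_atlas lie) (id_atlas dual)).

(* Tulczyjew's symplectic form at p: the complete lift to TT^*G of the canonical
   form d theta of T^*G, written in the trivialization.  A tangent vector
   V = ((Vg, dmu), (dxi, dnu)) has Vg = T_eR_g a in T_gG. *)
Definition tulczyjew (p : TTG) (V W : tangent tt_atlas p) : R :=
  let: ((g, mu), (xi, nu)) := p in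
  let: ((Vg, dmu), (dxi, dnu)) := V in
  let: ((Wg, dmu'), (dxi', dnu')) := W in
  let a := TRV g Vg in
  let a' := TRV g Wg in
  pairing dnu a' - pairing dnu' a + pairing nu (ad a a')
  + pairing dmu dxi' - pairing dmu' dxi.

(* Value at p of the right invariant vector field generated by the Lie algebra
   element z, for the group law
   (g, mu1, xi, mu2)(h, nu1, eta, nu2) = (gh, mu1 + Ad^*_g nu1, xi + Ad_g eta,
     mu2 + Ad^*_g nu2 - ad^*_{Ad_g eta} mu1). *)
Definition right_invariant (z : (lie * dual) * (lie * dual)) (p : TTG) :
    tangent tt_atlas p :=
  let: ((eta1, nu1), (eta2, nu2)) := z in
  let: ((g, mu), (xi, nu)) := p in
  ((TeR g eta1, nu1 + coad eta1 mu),
   (eta2 + ad eta1 xi, nu2 + coad eta1 nu - coad xi nu1)).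

Section PartialDerivatives.
Variables (E : TTG -> R^o) (p : TTG).
Let g := p.1.1.
Let mu := p.1.2.
Let xi := p.2.1.
Let nu := p.2.2.

Definition delta_g : dual :=
  covector (tangent_map (lie_atlas G) (id_atlas R^o)
              (fun h : G => E ((h, mu), (xi, nu))) g).
Definition delta_mu : lie :=
  vector_of ('d (fun m : dual => E ((g, m), (xi, nu))) mu).
Definition delta_xi : dual :=
  covector ('d (fun x : lie => E ((g, mu), (x, nu))) xi).
Definition delta_nu : lie :=
  vector_of ('d (fun m : dual => E ((g, mu), (xi, m))) nu).

End PartialDerivatives.

(* i_X Omega = - dE *)
Definition hamiltonian (E : TTG -> R^o) (X : forall p, tangent tt_atlas p) :
    Prop :=
  forall (p : TTG) (Y : tangent tt_atlas p),
    tulczyjew (X p) Y = - tangent_map tt_atlas (id_atlas R^o) E p Y.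

Definition integral_curve (X : forall p, tangent tt_atlas p) (J : set R)
    (c : R^o -> TTG) : Prop :=
  forall t, J t -> has_velocity tt_atlas c t (X (c t)).

End Lie.

(* Main.v *)
(* Since T_eR_g and T_gR_{g^-1} are inverse to each other, Tulczyjew's form is
   nondegenerate and Hamilton's equation can be solved for X_E component by
   component.  Agreement with the right invariant field needs that ad is
   alternating: in a chart around e, with m the multiplication,
   ad xi eta = D^2 m ((0, eta), (xi, 0)) - D^2 m ((0, xi), (eta, 0)), obtained
   by differentiating (x y x^-1) x = x y twice and using the symmetry of D^2 m.
   Smoothness of X_E is read off from its expression in a fixed chart, as
   compositions and derivatives of the local expressions of m and E. *)

Require Import Defs.
From HB Require Import structures.
From mathcomp Require Import all_boot all_order all_algebra.
From mathcomp Require Import all_classical all_reals all_analysis.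
From mathcomp Require Import ring.
Import Order.TTheory GRing.Theory Num.Theory.
Import numFieldNormedType.Exports.
Local Open Scope classical_set_scope.
Local Open Scope ring_scope.

Set Implicit Arguments.
Unset Strict Implicit.
Unset Printing Implicit Defensive.

Local Notation coord := Defs.coord.

(** * Differential calculus between normed spaces *)

Section Calculus.
Context {R : realType}.
Implicit Types E F H : normedModType R.

(** The main obstacle is that the components of a tangent vector at [p] refer to the preferred chart
    around [p], and this chart may jump as [p] varies. Hence [TeR g], [delta_g] and the closed
    formula for the field are meaningful point by point but show no smoothness. The remedy is to
    compute one derivative at the identity, that of [x |-> phi (x * g)], once through the chart at
    [g] and once through a fixed chart around [k]; uniqueness of the derivative gives the change of
    chart. A second obstacle is that [Ck] speaks of derivatives in fixed directions only, whereas
    the chain rule and right translation produce directions that move with the point. In finite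
    dimension such a direction expands in a fixed family with smooth coefficients. Antisymmetry of
    the bracket enters in one place: the generator contains [ad xi a] with [a = delta_nu], and the
    right invariant field adds [ad a xi]. *)

Lemma is_diff_near E F (f g df : E -> F) (x : E) :
  {near x, f =1 g} -> is_diff x f df -> is_diff x g df.
Proof.
move=> fg dfx; have dfc := diff_continuous (@ex_diff _ _ _ _ _ _ _ dfx).
(* The first-order expansion of [f] at [x] is also one for [g], and such an expansion has only one
   continuous linear part. So the derivative depends on the germ alone. *)
have gE : g \o shift x = cst (g x) + 'd f x +o_ 0 id.
  apply/eqaddoP => e e0.
  have /eqaddoP /(_ e e0) := diff_locally (@ex_diff _ _ _ _ _ _ _ dfx).
  have := fg; rewrite (near_shift 0 x) subr0; apply: filter_app2; near=> h.
  rewrite /= !fctE /= => fgh; rewrite (nbhs_singleton fg).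
  by move: fgh => /= <-.
have gd := diff_unique dfc gE.
by split; [apply/diff_locallyP; rewrite gd|rewrite gd diff_val].
Unshelve. all: by end_near. Qed.

Lemma is_diff_ext E F (f g df : E -> F) (x : E) :
  f =1 g -> is_diff x f df -> is_diff x g df.
Proof. by move=> /funext ->. Qed.

Lemma is_diff_linear E F (f : E -> F) (x : E) :
  linear f -> continuous f -> is_diff x f f.
Proof.
move=> lf cf; pose fL : {linear E -> F} :=
  HB.pack f (GRing.isLinear.Build _ _ _ _ _ lf).
by have /differentiableP := @linear_differentiable _ _ _ fL x cf;
  rewrite diff_lin.
Qed.

Lemma is_diff_fst E F (z : E * F) : is_diff z fst (fun v : E * F => v.1).
Proof. by apply: is_diff_linear => // u; exact: cvg_fst. Qed.

Lemma is_diff_snd E F (z : E * F) : is_diff z snd (fun v : E * F => v.2).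
Proof. by apply: is_diff_linear => // u; exact: cvg_snd. Qed.

Lemma is_diff_scale E F (a da : E -> R^o) (b db : E -> F) (x : E) :
  is_diff x a da -> is_diff x b db ->
  is_diff x (fun y => a y *: b y) (fun v => a x *: db v + da v *: b x).
Proof.
move=> dax dbx.
have lin : bilinear_for (GRing.Scale.Law.clone _ _ *:%R _)
    (GRing.Scale.Law.clone _ _ *:%R _) (fun (k : R^o) (v : F) => k *: v).
  split=> [u'|u] k y z /=; first by rewrite scalerDl scalerA.
  by rewrite scalerDr !scalerA mulrC.
pose s : {bilinear R^o -> F -> F} :=
  HB.pack (fun (k : R^o) (v : F) => k *: v)
   (bilinear_isBilinear.Build R R^o F F _ _ _ lin).
have sc : continuous (fun p : R^o * F => s p.1 p.2).
  by move=> p; apply: scale_continuous.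
have ds p : is_diff p (fun p : R^o * F => s p.1 p.2)
    (fun q : R^o * F => s p.1 q.2 + s q.1 p.2).
  by split; [exact: differentiable_bilin | exact: diff_bilin].
exact: (is_diff_comp (is_diff_pair dax dbx) (ds (a x, b x))).
Qed.


(* Depends only on the germ of f at x, so that no domain has to be carried
   through sums, products and compositions. *)
Fixpoint Ck_at E F (k : nat) (f : E -> F) (x : E) : Prop :=
  if k is k'.+1 then
    (\near x, differentiable f x) /\
    (forall v : E, Ck_at k' (fun y => 'd f y v) x)
  else {for x, continuous f}.

Definition smooth_at E F (f : E -> F) (x : E) : Prop := forall k, Ck_at k f x.

(** The points around which [f] and [g] agree again form a neighbourhood of [x] ([near_join]), so
    the directional derivatives have equal germs too and the induction applies to them. *)
Lemma Ck_at_near E F k (f g : E -> F) (x : E) :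
  {near x, f =1 g} -> Ck_at k f x -> Ck_at k g x.
Proof.
elim: k f g => [|k IH] f g fg /=.
  move=> fc; change (g @ x --> g x); rewrite -(nbhs_singleton fg).
  by apply: cvg_trans fc; apply: near_eq_cvg; apply: filterS fg.
move=> [df dfv].
have dg : \near x, is_diff x g ('d f x).
  near=> y; have fgy : {near y, f =1 g} by near: y; exact: near_join fg.
  by apply: is_diff_near fgy _; apply: differentiableP; near: y.
split; first by apply: filterS dg => y [].
move=> v; apply: IH (dfv v); apply: filterS dg => y dgy.
by rewrite [in RHS]diff_val.
Unshelve. all: by end_near. Qed.

Lemma Ck_atW E F k (f : E -> F) (x : E) : Ck_at k.+1 f x -> Ck_at k f x.
Proof.
elim: k f => [|k IH] f [df dfv].
  exact: differentiable_continuous (nbhs_singleton df).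
by split=> // v; apply: IH.
Qed.

(** Bridge between the smoothness on sets used by atlases and the smoothness of germs: an open set
    is a neighbourhood of each of its points. *)
Lemma smooth_onP E F (U : set E) (f : E -> F) : open U ->
  smooth_on U f <-> forall x, U x -> smooth_at f x.
Proof.
move=> oU; split=> [fU x Ux k|fU k].
  elim: k f {fU}(fU k) => [|k IH] f; first by apply.
  move=> [df dfv]; split; last by move=> v; exact: IH (dfv v).
  have : nbhs x U by exact: open_nbhs_nbhs.
  exact: filterS.
elim: k f {fU}(fun x Ux => fU x Ux k) => [|k IH] f fU; first by [].
split=> [x Ux|v].
  by have [df _] := fU x Ux; exact: nbhs_singleton df.
by apply: IH => x Ux; have [_ dfv] := fU x Ux; exact: dfv.
Qed.

Lemma Ck_at_cst E F k (a : F) (x : E) : Ck_at k (fun=> a) x.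
Proof.
elim: k a => [|k IH] a; first exact: cvg_cst.
split; first by apply: nearW => y; exact: differentiable_cst.
move=> v; under eq_fun do rewrite diff_cst.
exact: IH.
Qed.

Lemma Ck_at_linear E F k (f : E -> F) (x : E) :
  linear f -> continuous f -> Ck_at k f x.
Proof.
move=> lf cf; case: k => [|k]; first exact: cf.
have df y := is_diff_linear y lf cf.
split=> [|v]; first by apply: nearW => y; have [] := df y.
under eq_fun do rewrite diff_val.
exact: Ck_at_cst.
Qed.

Lemma Ck_atD E F k (f g : E -> F) (x : E) :
  Ck_at k f x -> Ck_at k g x -> Ck_at k (fun y => f y + g y) x.
Proof.
elim: k f g => [|k IH] f g; first exact: cvgD.
move=> [df dfv] [dg dgv]; split.
  by near=> y; apply: differentiableD; near: y.
move=> v; apply: Ck_at_near (IH _ _ (dfv v) (dgv v)); near=> y.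
by rewrite [RHS](_ : _ = 'd (f + g) y v)// diffD//; near: y.
Unshelve. all: by end_near. Qed.

Lemma Ck_at_sum E F k (I : finType) (f : I -> E -> F) (x : E) :
  (forall i, Ck_at k (f i) x) -> Ck_at k (fun y => \sum_i f i y) x.
Proof.
move=> fk;
have -> : (fun y => \sum_i f i y) = \sum_i f i.
  by apply: funext => y; rewrite fct_sumE.
elim/big_ind : _ => [|g h|i _]; [exact: Ck_at_cst|exact: Ck_atD|exact: fk].
Qed.

(** By the Leibniz rule each term of the derivative keeps one factor undifferentiated; [Ck_atW]
    lowers its order to the one that the induction expects. *)
Lemma Ck_at_scale E F k (a : E -> R^o) (b : E -> F) (x : E) :
  Ck_at k a x -> Ck_at k b x -> Ck_at k (fun y => a y *: b y) x.
Proof.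
elim: k a b => [|k IH] a b; first exact: cvgZ.
move=> ka kb; have [[da dav] [db dbv]] := (ka, kb); split.
  near=> y; have day : is_diff y a ('d a y) by apply: differentiableP; near: y.
  have dby : is_diff y b ('d b y) by apply: differentiableP; near: y.
  by have [] := is_diff_scale day dby.
move=> v.
apply: Ck_at_near (Ck_atD (IH _ _ (Ck_atW ka) (dbv v))
  (IH _ _ (dav v) (Ck_atW kb))).
near=> y; have day : is_diff y a ('d a y) by apply: differentiableP; near: y.
have dby : is_diff y b ('d b y) by apply: differentiableP; near: y.
by have [_ ->] := is_diff_scale day dby.
Unshelve. all: by end_near. Qed.

Lemma Ck_at_post_linear E F H k (l : F -> H) (f : E -> F) (x : E) :
  linear l -> continuous l -> Ck_at k f x -> Ck_at k (fun y => l (f y)) x.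
Proof.
move=> ll cl; have dl y := is_diff_linear y ll cl.
elim: k f => [|k IH] f; first by move=> fc; apply: continuous_comp fc _; exact: cl.
move=> [df dfv]; have dlf : \near x, is_diff x (l \o f) (l \o 'd f x).
  near=> y; apply: is_diff_comp (dl _); apply: differentiableP; near: y.
  exact: df.
split; first by apply: filterS dlf => y [].
move=> v; apply: Ck_at_near (IH _ (dfv v)); apply: filterS dlf => y [_].
by move=> /(congr1 (fun h => h v)).
Unshelve. all: by end_near. Qed.

(** Finite dimension in the form the calculus consumes: a finite spanning family with continuous
    linear coefficients. It turns a derivative in a moving direction into a combination of
    derivatives in the fixed directions [e i]. *)
Definition findim F : Prop := exists (I : finType) (e : I -> F) (p : I -> F -> R^o),
  [/\ forall i, linear (p i), forall i, continuous (p i) &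
      forall v, v = \sum_i p i v *: e i].

(** The derivative of [g \o f] is ['d g (f y) ('d f y v)], whose direction varies with [y]. Expanded
    along [e], it becomes a sum of products of a coefficient of ['d f y v] with ['d g (f y) (e i)],
    and the induction hypothesis applies to the second factor. *)
Lemma Ck_at_comp E F H k (f : E -> F) (g : F -> H) (x : E) : findim F ->
  Ck_at k f x -> Ck_at k g (f x) -> Ck_at k (g \o f) x.
Proof.
move=> [I [e [p [lp cp pE]]]].
elim: k g => [|k IH] g; first by move=> fc gc; apply: continuous_comp.
move=> kf [dg dgv]; have [df dfv] := kf.
have fc : {for x, continuous f}.
  by apply: differentiable_continuous; exact: nbhs_singleton df.
have dgf : \near x, is_diff x (g \o f) ('d g (f x) \o 'd f x).
  near=> y; apply: is_diff_comp; apply: differentiableP; near: y => //.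
  exact: fc dg.
split; first by apply: filterS dgf => y [].
move=> v; have := Ck_at_sum (fun i => Ck_at_scale
  (Ck_at_post_linear (lp i) (cp i) (dfv v)) (IH _ (Ck_atW kf) (dgv (e i)))).
apply: Ck_at_near; apply: filterS dgf => y [_ ->] /=.
by rewrite [in RHS](pE ('d f y v)) linear_sum; under [RHS]eq_bigr do rewrite linearZ.
Unshelve. all: by end_near. Qed.

End Calculus.

(** * Closure properties of smooth germs and derivatives in moving directions *)

Section SmoothAt.
Context {R : realType}.
Implicit Types E F H : normedModType R.

Lemma smooth_at_near E F (f g : E -> F) (x : E) :
  {near x, f =1 g} -> smooth_at f x -> smooth_at g x.
Proof. by move=> fg sf k; exact: Ck_at_near fg (sf k). Qed.

Lemma smooth_at_cst E F (a : F) (x : E) : smooth_at (fun=> a) x.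
Proof. by move=> k; exact: Ck_at_cst. Qed.

Lemma smooth_at_linear E F (f : E -> F) (x : E) :
  linear f -> continuous f -> smooth_at f x.
Proof. by move=> lf cf k; exact: Ck_at_linear. Qed.

Lemma smooth_atD E F (f g : E -> F) (x : E) :
  smooth_at f x -> smooth_at g x -> smooth_at (fun y => f y + g y) x.
Proof. by move=> sf sg k; exact: Ck_atD. Qed.

Lemma smooth_at_sum E F (I : finType) (f : I -> E -> F) (x : E) :
  (forall i, smooth_at (f i) x) -> smooth_at (fun y => \sum_i f i y) x.
Proof. by move=> sf k; apply: Ck_at_sum => i; exact: sf. Qed.

Lemma smooth_at_scale E F (a : E -> R^o) (b : E -> F) (x : E) :
  smooth_at a x -> smooth_at b x -> smooth_at (fun y => a y *: b y) x.
Proof. by move=> sa sb k; exact: Ck_at_scale. Qed.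

Lemma smooth_atN E F (f : E -> F) (x : E) :
  smooth_at f x -> smooth_at (fun y => - f y) x.
Proof.
move=> sf; under eq_fun do rewrite -scaleN1r.
by apply: smooth_at_scale => //; exact: smooth_at_cst.
Qed.

Lemma smooth_at_post_linear E F H (l : F -> H) (f : E -> F) (x : E) :
  linear l -> continuous l -> smooth_at f x -> smooth_at (fun y => l (f y)) x.
Proof. by move=> ll cl sf k; exact: Ck_at_post_linear. Qed.

Lemma smooth_at_comp E F H (f : E -> F) (g : F -> H) (x : E) : findim F ->
  smooth_at f x -> smooth_at g (f x) -> smooth_at (fun y => g (f y)) x.
Proof. by move=> dF sf sg k; exact: Ck_at_comp. Qed.

Lemma smooth_at_id E (x : E) : smooth_at (fun y : E => y) x.
Proof. by apply: smooth_at_linear => // y; exact: cvg_id. Qed.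

Lemma smooth_at_fst E F (x : E * F) : smooth_at (fun y : E * F => y.1) x.
Proof. by apply: smooth_at_linear => // y; exact: cvg_fst. Qed.

Lemma smooth_at_snd E F (x : E * F) : smooth_at (fun y : E * F => y.2) x.
Proof. by apply: smooth_at_linear => // y; exact: cvg_snd. Qed.

(** A pair is the sum of its images under the two linear injections into the product, so sums and
    linear post-composition suffice. *)
Lemma smooth_at_pair E F H (f : E -> F) (g : E -> H) (x : E) :
  smooth_at f x -> smooth_at g x -> smooth_at (fun y => (f y, g y)) x.
Proof.
move=> sf sg.
have li : linear (fun y : F => (y, 0 : H)).
  by move=> k u v; apply/pair_equal_spec; split; rewrite //= scaler0 addr0.
have lj : linear (fun y : H => (0 : F, y)).
  by move=> k u v; apply/pair_equal_spec; split; rewrite //= scaler0 addr0.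
have ci : continuous (fun y : F => (y, 0 : H)).
  by move=> y; apply: cvg_pair; [exact: cvg_id|exact: cvg_cst].
have cj : continuous (fun y : H => (0 : F, y)).
  by move=> y; apply: cvg_pair; [exact: cvg_cst|exact: cvg_id].
have := smooth_atD (smooth_at_post_linear li ci sf)
  (smooth_at_post_linear lj cj sg).
apply: smooth_at_near; apply: nearW => y /=.
by apply/pair_equal_spec; rewrite /= addr0 add0r.
Qed.

Lemma smooth_at_diff E F (f : E -> F) (x v : E) :
  smooth_at f x -> smooth_at (fun y => 'd f y v) x.
Proof. by move=> sf k; have [_ dfv] := sf k.+1; exact: dfv. Qed.

Lemma smooth_at_near_differentiable E F (f : E -> F) (x : E) :
  smooth_at f x -> \near x, differentiable f x.
Proof. by move=> sf; have [] := sf 1%N. Qed.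

Lemma smooth_at_differentiable E F (f : E -> F) (x : E) :
  smooth_at f x -> differentiable f x.
Proof. by move=> /smooth_at_near_differentiable/nbhs_singleton. Qed.

Lemma smooth_at_continuous E F (f : E -> F) (x : E) :
  smooth_at f x -> {for x, continuous f}.
Proof. by move=> sf; exact: sf 0%N. Qed.

(** Both the base point and the direction move; the direction is expanded along the fixed family, as
    in the chain rule. *)
Lemma smooth_at_dapp E F H (h w : E -> F) (f : F -> H) (x : E) : findim F ->
  smooth_at h x -> smooth_at w x -> smooth_at f (h x) ->
  smooth_at (fun y => 'd f (h y) (w y)) x.
Proof.
move=> dF sh sw sf; have [I [e [p [lp cp pE]]]] := dF.
have := smooth_at_sum (fun i => smooth_at_scale
  (smooth_at_post_linear (lp i) (cp i) sw)
  (smooth_at_comp dF sh (smooth_at_diff (e i) sf))).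
apply: smooth_at_near; apply: nearW => y.
rewrite [in RHS](pE (w y)) linear_sum.
by under [RHS]eq_bigr do rewrite linearZ.
Qed.

Lemma is_diff_sum E F (I : finType) (f df : I -> E -> F) (x : E) :
  (forall i, is_diff x (f i) (df i)) ->
  is_diff x (fun y => \sum_i f i y) (fun y => \sum_i df i y).
Proof.
move=> dfx.
have -> : (fun y => \sum_i f i y) = \sum_i f i.
  by apply: funext => y; rewrite fct_sumE.
have -> : (fun y => \sum_i df i y) = \sum_i df i.
  by apply: funext => y; rewrite fct_sumE.
elim/big_rec2 : _ => [|i g dg _ IH]; first exact: is_diff_cst.
exact: is_diffD.
Qed.

(** Leibniz rule for applying a derivative to a vector: the moving base point gives a second
    derivative with the direction frozen at [w x], the moving direction gives the first derivative
    at [dw v]. *)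
Lemma is_diff_dapp E F H (h w dh dw : E -> F) (f : F -> H) (x : E) :
  findim F -> smooth_at f (h x) -> is_diff x h dh -> is_diff x w dw ->
  is_diff x (fun y => 'd f (h y) (w y))
    (fun v => 'd (fun z => 'd f z (w x)) (h x) (dh v) + 'd f (h x) (dw v)).
Proof.
move=> dF sf dhx dwx; have [I [e [p [lp cp pE]]]] := dF.
have fE z v : 'd f z v = \sum_i p i v *: 'd f z (e i).
  rewrite [in LHS](pE v) linear_sum; apply: eq_bigr => i _; exact: linearZ.
have dfe i : is_diff (h x) (fun z => 'd f z (e i))
    ('d (fun z => 'd f z (e i)) (h x)).
  by apply/differentiableP/smooth_at_differentiable; exact: smooth_at_diff.
(* With [v] frozen, the coefficients [p i v] are constants; this regroups the coordinate sum into
   one second derivative. *)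
have dcoef v : 'd (fun z => 'd f z v) (h x) =
    (fun u => \sum_i p i v *: 'd (fun z => 'd f z (e i)) (h x) u) :> (F -> H).
  under eq_fun do rewrite fE.
  have := is_diff_sum (fun i => is_diffZ (p i v) (dfe i)).
  by case.
have dterm i := is_diff_scale
  (is_diff_comp dwx (is_diff_linear (w x) (lp i) (cp i)))
  (is_diff_comp dhx (dfe i)).
under eq_fun do rewrite fE.
apply: is_diff_eq (is_diff_sum dterm) _; apply: funext => v /=.
by rewrite big_split /= dcoef fE.
Qed.

Lemma findim_prod E F : findim E -> findim F -> findim (E * F)%type.
Proof.
move=> [I [e [p [lp cp pE]]]] [J [f [q [lq cq qE]]]].
exists (I + J)%type, (fun s => match s with
  inl i => (e i, 0) | inr j => (0, f j) end),
  (fun s v => match s with inl i => p i v.1 | inr j => q j v.2 end); split.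
- by move=> [i|j] k u v /=; [rewrite lp|rewrite lq].
- move=> [i|j] u.
    by apply: (continuous_comp (f := fst)); [exact: cvg_fst|exact: cp].
  by apply: (continuous_comp (f := snd)); [exact: cvg_snd|exact: cq].
- move=> [u v]; rewrite big_sumType /=; apply/pair_equal_spec => /=; split.
    rewrite [LHS](pE u) !raddf_sum /= [X in _ + X]big1 ?addr0// => j _.
    by rewrite scaler0.
  rewrite [LHS](qE v) !raddf_sum /= [X in X + _]big1 ?add0r// => i _.
  by rewrite scaler0.
Qed.

Lemma linear_coord m n i j : linear (fun v : 'M[R]_(m, n) => v i j : R^o).
Proof. by move=> k u v; rewrite !mxE. Qed.

Lemma findim_mx m n : findim 'M[R]_(m, n).
Proof.
exists ('I_m * 'I_n)%type, (fun ij => delta_mx ij.1 ij.2),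
  (fun ij (v : 'M[R]_(m, n)) => v ij.1 ij.2); split.
- by move=> [i j]; exact: linear_coord.
- by move=> [i j]; exact: coord_continuous.
- by move=> v; rewrite -(pair_bigA _ (fun i j => v i j *: delta_mx i j))
    -matrix_sum_delta.
Qed.

End SmoothAt.

(** * Symmetry of second derivatives *)

Section Schwarz.
Context {R : realType}.
Implicit Types E F H : normedModType R.

Lemma is_diff_derive E F (f df : E -> F) (x v : E) :
  is_diff x f df -> is_derive x v f (df v).
Proof.
move=> dfx; split; first exact: diff_derivable (@ex_diff _ _ _ _ _ _ _ dfx).
by rewrite deriveE// diff_val.
Qed.

Lemma is_diff_line E (x v : E) (t : R^o) :
  is_diff t (fun s : R^o => x + s *: v) (fun s => s *: v).
Proof.
exact: is_diff_eq (is_diffD (is_diff_cst x t) (is_diff_scalel t v)) (add0r _).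
Qed.

Lemma is_derive_along_line E (f : E -> R^o) (x v : E) (t : R) :
  differentiable f (x + t *: v) ->
  is_derive t 1 (fun s : R => f (x + s *: v)) ('d f (x + t *: v) v).
Proof.
move=> /differentiableP df.
have := is_diff_derive (1 : R^o) (is_diff_comp (is_diff_line x v t) df).
by rewrite /= scale1r.
Qed.

Lemma continuous_along_line E (f : E -> R^o) (x v : E) (t : R) :
  differentiable f (x + t *: v) ->
  {for t, continuous (fun s : R => f (x + s *: v))}.
Proof.
move=> df; apply/differentiable_continuous/derivable1_diffP.
by have [] := is_derive_along_line df.
Qed.

(* Two mean value theorems: first in direction v, then in direction w. *)
Lemma second_difference E (f : E -> R^o) (x v w : E) (d : R) : 0 < d ->
  (forall a b : R, 0 <= a <= d -> 0 <= b <= d ->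
     differentiable f (x + a *: v + b *: w) /\
     differentiable (fun z => 'd f z v : R^o) (x + a *: v + b *: w)) ->
  exists a b : R, [/\ 0 <= a <= d, 0 <= b <= d &
    f (x + d *: v + d *: w) - f (x + d *: v) - (f (x + d *: w) - f x)
    = 'd (fun z => 'd f z v : R^o) (x + a *: v + b *: w) w * d * d].
Proof.
move=> d0 df.
have dd : 0 <= d <= d by rewrite (lexx d) (ltW d0).
have zd : 0 <= (0 : R) <= d by rewrite (lexx (0 : R)) (ltW d0).
have df0 (a : R) : 0 <= a <= d -> differentiable f (x + a *: v).
  by move=> ad; have [+ _] := df a 0 ad zd; rewrite scale0r addr0.
have dfd (a : R) : 0 <= a <= d -> differentiable f (x + d *: w + a *: v).
  by move=> ad; have [+ _] := df a d ad dd; rewrite addrAC.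
(* [g a] is the increment of [f] along [d *: w] from the point [x + a *: v]. Then [g d - g 0] is the
   second difference, while [dg a] is itself the increment over [[0, d]] of the function [h]
   below. *)
pose g (a : R) := f (x + d *: w + a *: v) - f (x + a *: v).
pose dg (a : R) := 'd f (x + d *: w + a *: v) v - 'd f (x + a *: v) v.
have gd a : a \in `]0, d[%R -> is_derive a 1 g (dg a).
  rewrite in_itv /= => /andP[a0 ad].
  have aI : 0 <= a <= d by rewrite !ltW.
  exact: is_deriveB (is_derive_along_line (dfd a aI))
    (is_derive_along_line (df0 a aI)).
have gc : {within `[0, d], continuous g}.
  apply: continuous_in_subspaceT => a; rewrite inE /= in_itv /= => aI.
  exact: continuousB (continuous_along_line (dfd a aI))
    (continuous_along_line (df0 a aI)).
have [a aI gE] := MVT d0 gd gc.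
have {}aI : 0 <= a <= d by move: aI; rewrite in_itv /= => /andP[/ltW -> /ltW].
pose h (b : R) := 'd f (x + a *: v + b *: w) v.
have hd b : b \in `]0, d[%R ->
    is_derive b 1 h ('d (fun z => 'd f z v : R^o) (x + a *: v + b *: w) w).
  rewrite in_itv /= => /andP[b0 bd].
  have bI : 0 <= b <= d by rewrite !ltW.
  by apply: is_derive_along_line; have [] := df a b aI bI.
have hc : {within `[0, d], continuous h}.
  apply: continuous_in_subspaceT => b; rewrite inE /= in_itv /= => bI.
  apply: (@continuous_along_line _ (fun z => 'd f z v : R^o)).
  by have [] := df a b aI bI.
have [b bI hE] := MVT d0 hd hc.
have {}bI : 0 <= b <= d by move: bI; rewrite in_itv /= => /andP[/ltW -> /ltW].
exists a, b; split=> //.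
move: hE gE; rewrite /h /g /dg !subr0 !scale0r !addr0 => <-.
by rewrite [x + a *: v + d *: w]addrAC [x + d *: v + d *: w]addrAC => <-.
Qed.

(** The second difference is symmetric in [v] and [w], so both mixed derivatives, taken at suitable
    points near [x], equal the same quotient by [d * d]. Continuity of the two at [x] concludes. *)
Lemma schwarz_real E (f : E -> R^o) (x v w : E) : smooth_at f x ->
  'd (fun z => 'd f z v : R^o) x w = 'd (fun z => 'd f z w : R^o) x v.
Proof.
move=> sf; set A := fun z => 'd (fun z => 'd f z v : R^o) z w.
set B := fun z => 'd (fun z => 'd f z w : R^o) z v.
have sv := smooth_at_diff v sf; have sw := smooth_at_diff w sf.
have cA : {for x, continuous (A : E -> R^o)}.
  by apply: smooth_at_continuous; exact: smooth_at_diff.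
have cB : {for x, continuous (B : E -> R^o)}.
  by apply: smooth_at_continuous; exact: smooth_at_diff.
apply/eqP; rewrite -subr_eq0 -normr_le0; apply/ler_addgt0Pl => e e0.
rewrite addr0 -/(A x) -/(B x).
have e20 : 0 < e / 2 by rewrite divr_gt0.
have near_x : \near x, [/\ differentiable f x,
    differentiable (fun z => 'd f z v : R^o) x &
    differentiable (fun z => 'd f z w : R^o) x].
  by near=> y; split; near: y; exact: smooth_at_near_differentiable.
have : \forall y \near x, [/\ `|A x - A y| < e / 2, `|B x - B y| < e / 2,
    differentiable f y, differentiable (fun z => 'd f z v : R^o) y &
    differentiable (fun z => 'd f z w : R^o) y].
  near=> y; have [] : [/\ differentiable f y,
    differentiable (fun z => 'd f z v : R^o) y &
    differentiable (fun z => 'd f z w : R^o) y] by near: y; exact: near_x.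
  split=> //; near: y.
    by have /cvgrPdist_lt/(_ _ e20) := cA.
  by have /cvgrPdist_lt/(_ _ e20) := cB.
move=> /nbhs_normP[r /= r0 xr].
(* Chosen so that the parallelogram spanned by [d *: v] and [d *: w] at [x] stays within distance
   [r / 2] of [x]; the summand [1] keeps the denominator positive when both vectors vanish. *)
pose d := r / 2 / (`|v| + `|w| + 1).
have vw0 : 0 < `|v| + `|w| + 1 by rewrite ltr_wpDl// addr_ge0.
have d0 : 0 < d by rewrite !divr_gt0.
have in_ball (a b : R) : 0 <= a <= d -> 0 <= b <= d ->
    `|x - (x + a *: v + b *: w)| < r.
  move=> /andP[a0 ad] /andP[b0 bd]; rewrite -addrA opprD addrA subrr add0r normrN.
  apply: le_lt_trans (ler_normD _ _) _; rewrite !normrZ !ger0_norm//.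
  apply: (@le_lt_trans _ _ (d * (`|v| + `|w| + 1))).
    rewrite !mulrDr mulr1 -[leLHS]addr0 lerD ?(ltW d0)// lerD// ler_wpM2r//.
  by rewrite divfK ?gt_eqF// ltr_pdivrMr// ltr_pMr// ltr1n.
have in_ball' (a b : R) : 0 <= a <= d -> 0 <= b <= d ->
    `|x - (x + a *: w + b *: v)| < r.
  by move=> ad bd; rewrite addrAC; exact: in_ball.
have [a [b [aI bI vwE]]] := @second_difference _ f x v w d d0
  (fun a b aI bI => let: And5 _ _ p q _ := xr _ (in_ball a b aI bI) in conj p q).
have [a' [b' [aI' bI' wvE]]] := @second_difference _ f x w v d d0
  (fun a b aI bI => let: And5 _ _ p _ q := xr _ (in_ball' a b aI bI) in conj p q).
have AB : A (x + a *: v + b *: w) = B (x + a' *: w + b' *: v).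
  have dd0 : d != 0 by rewrite gt_eqF.
  apply: (mulIf dd0); apply: (mulIf dd0).
  rewrite -[LHS]vwE -[RHS]wvE [x + d *: w + _]addrAC.
  by rewrite !opprB addrACA [RHS]addrACA [- _ - _]addrC.
have [Aa _ _ _ _] := xr _ (in_ball a b aI bI).
have [_ Bb _ _ _] := xr _ (in_ball' a' b' aI' bI').
(* Since [A] and [B] take a common value at their two mean value points, [A x - B x] splits there
   into two increments, each smaller than [e / 2]. *)
rewrite -(subrKA (A (x + a *: v + b *: w))) {2}AB [e]splitr.
by apply: le_trans (ler_normD _ _) _; rewrite [`|B _ - B _|]distrC lerD// ltW.
Unshelve. all: by end_near. Qed.

(** Each coordinate [p i] is linear and continuous, hence commutes with both differentiations, which
    reduces the claim to real-valued maps. The inner commutation holds only where [f] is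
    differentiable, that is near [x], so the outer derivative is compared by germs. *)
Lemma schwarz E F (f : E -> F) (x v w : E) : findim F -> smooth_at f x ->
  'd (fun z => 'd f z v) x w = 'd (fun z => 'd f z w) x v.
Proof.
move=> [I [e [p [lp cp pE]]]] sf.
have second i a b : 'd (fun z => 'd (fun y => p i (f y) : R^o) z a : R^o) x b =
    p i ('d (fun z => 'd f z a) x b).
  have dp y := is_diff_linear y (lp i) (cp i).
  have : is_diff x (fun z => p i ('d f z a))
      (fun b => p i ('d (fun z => 'd f z a) x b)).
    apply: is_diff_comp (dp _); apply/differentiableP/smooth_at_differentiable.
    exact: smooth_at_diff.
  suff nE : {near x, (fun z => p i ('d f z a)) =1
      (fun z => 'd (fun y => p i (f y) : R^o) z a : R^o)}.
    by move=> /(is_diff_near nE)[_ ->].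
  near=> y; have df : differentiable f y.
    by near: y; exact: smooth_at_near_differentiable.
  by have [_ /(congr1 (fun h => h a))] := is_diff_comp (differentiableP df) (dp _).
rewrite [LHS]pE [RHS]pE; apply: eq_bigr => i _.
by rewrite -!second schwarz_real//; exact: smooth_at_post_linear.
Unshelve. all: by end_near. Qed.
End Schwarz.

(** * Maps between manifolds in charts *)

Section ManifoldMaps.
Context {R : realType}.
Implicit Types E F H : normedModType R.

Lemma mem_coord E (M : topologicalType) (c : chart E M) (x : M) :
  dom c x -> nbhs (coord c x) (coord c @` dom c).
Proof. by move=> cx; apply: open_nbhs_nbhs; split; [exact: open_coord|exists x]. Qed.

Lemma uncoordK E (M : topologicalType) (c : chart E M) (x : M) :
  dom c x -> \forall u \near coord c x, coord c (uncoord c u) = u.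
Proof.
move=> cx; apply: filterS (mem_coord cx) => _ [y cy <-].
by rewrite coordK.
Qed.

(** The domains in [smooth] and [is_manifold] are of this form, and the passage to germs needs them
    open. A point near [coord c x] is the image of a point near [x], by continuity of [uncoord]. *)
Lemma open_coord_image E (M : topologicalType) (c : chart E M) (V : set M) :
  open V -> open (coord c @` (dom c `&` V)).
Proof.
move=> oV; rewrite openE => _ [x [cx Vx] <-].
have /uncoord_continuous := cx; rewrite /prop_for /continuous_at coordK// => uc.
near=> u; have [y cy yu] : (coord c @` dom c) u.
  by near: u; exact: mem_coord.
exists y => //; split=> //; rewrite -(coordK cy) yu; near: u.
by apply: uc; exact: open_nbhs_nbhs.
Unshelve. all: by end_near. Qed.

(** The charts are those preferred at [x] and [y], while the germ is taken at another point [z]: one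
    chart serves for all points of its domain. *)
Lemma smooth_local E F (M N : topologicalType) (A : atlas E M) (B : atlas F N)
    (f : M -> N) (x z : M) (y : N) :
  smooth A B f -> dom (A x) z -> dom (B y) (f z) ->
  smooth_at (fun u => coord (B y) (f (uncoord (A x) u))) (coord (A x) z).
Proof.
move=> [fc sf] xz yfz; have /smooth_onP : open (coord (A x) @`
    (dom (A x) `&` f @^-1` dom (B y))).
  apply: open_coord_image; apply: open_comp; last exact: open_dom.
  by move=> t _; exact: fc.
by move=> /(_ _ (coord (B y) \o f \o uncoord (A x)))[/(_ (sf x y)) + _]; apply; exists z.
Qed.

Lemma smooth_transition E (M : topologicalType) (A : atlas E M) (x y z : M) :
  is_manifold A -> dom (A x) z -> dom (A y) z ->
  smooth_at (fun u => coord (A y) (uncoord (A x) u)) (coord (A x) z).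
Proof.
move=> [_ _ sA] xz yz; have /smooth_onP : open (coord (A x) @`
    (dom (A x) `&` dom (A y))) by apply: open_coord_image; exact: open_dom.
by move=> /(_ _ (coord (A y) \o uncoord (A x)))[/(_ (sA x y)) + _]; apply; exists z.
Qed.

(** Chain rule across a manifold. Inserting [uncoord c] after [coord c] changes nothing near [u],
    because continuity keeps [f] inside the domain of [c]. *)
Lemma is_diff_through_chart E F H (M : topologicalType) (c : chart E M)
    (f : F -> M) (phi : M -> H) (u : F) df dphi :
  {for u, continuous f} -> dom c (f u) ->
  is_diff u (fun y => coord c (f y)) df ->
  is_diff (coord c (f u)) (fun y => phi (uncoord c y)) dphi ->
  is_diff u (fun y => phi (f y)) (dphi \o df).
Proof.
move=> fc cfu dfu dphiu.
apply: is_diff_near (is_diff_comp dfu dphiu).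
near=> y => /=; rewrite coordK//; near: y.
by apply: fc; apply: open_nbhs_nbhs; split=> //; exact: open_dom.
Unshelve. all: by end_near. Qed.

Lemma uncoord_continuous_at E (M : topologicalType) (A : atlas E M) (x : M) :
  uncoord (A x) u @[u --> coord (A x) x] --> x.
Proof.
have := uncoord_continuous (mem_chart_at A x).
by rewrite /prop_for /continuous_at coordK//; exact: mem_chart_at.
Qed.

Lemma mdifferentiable_is_diff E F (M N : topologicalType) (A : atlas E M)
    (B : atlas F N) (f : M -> N) (x : M) :
  mdifferentiable A B f x ->
  is_diff (coord (A x) x) (fun u => coord (B (f x)) (f (uncoord (A x) u)))
    (tangent_map A B f x).
Proof. by move=> [_ df]; exact: differentiableP. Qed.

Lemma tangent_map_comp E F H (M N P : topologicalType) (A : atlas E M)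
    (B : atlas F N) (C : atlas H P) (f : M -> N) (g : N -> P) (x : M) v :
  mdifferentiable A B f x -> mdifferentiable B C g (f x) ->
  tangent_map A C (g \o f) x v = tangent_map B C g (f x) (tangent_map A B f x v).
Proof.
move=> fx gfx; have xA := mem_chart_at A x; have fxB := mem_chart_at B (f x).
have fc : {for coord (A x) x, continuous (f \o uncoord (A x))}.
  have fxc : f t @[t --> x] --> f x by case: fx.
  rewrite /prop_for /continuous_at /= coordK//.
  exact: cvg_comp (@uncoord_continuous_at _ _ A x) fxc.
have ufx : f (uncoord (A x) (coord (A x) x)) = f x by rewrite coordK.
have := @is_diff_through_chart _ _ _ _ (B (f x)) (f \o uncoord (A x))
  (fun y => coord (C (g (f x))) (g y)) _ _ _ fc _ (mdifferentiable_is_diff fx).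
rewrite /= ufx => /(_ _ fxB (mdifferentiable_is_diff gfx))[_].
by move=> /(congr1 (fun h => h v)).
Qed.

Lemma tangent_map_id E (M : topologicalType) (A : atlas E M) (x : M) v :
  tangent_map A A id x v = v.
Proof.
have : is_diff (coord (A x) x) (local_rep A A id x) id.
  apply: is_diff_near (is_diff_id _).
  by apply: filterS (uncoordK (mem_chart_at A x)) => u uE; rewrite /local_rep /= uE.
by case=> _ /(congr1 (fun h => h v)).
Qed.

End ManifoldMaps.

(** * Lie groups *)

Section LieGroupCalculus.
Context {R : realType} {n : nat} (G : lieGroup R n).
Local Notation lie := 'rV[R]_n.
Local Notation ch := (lie_atlas G).
Local Notation c1 := (lie_atlas G 1%g).
Local Notation x0 := (coord c1 1%g).

Lemma mul_smooth_at (a b k g h : G) : dom (ch a) g -> dom (ch b) h ->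
  dom (ch k) (g * h)%g ->
  smooth_at (fun u : lie * lie =>
    coord (ch k) (uncoord (ch a) u.1 * uncoord (ch b) u.2)%g)
    (coord (ch a) g, coord (ch b) h).
Proof.
move=> ag bh kgh.
exact: (@smooth_local _ _ _ _ _ _ _ _ (a, b) (g, h) k (lie_mul_smooth G)).
Qed.

Lemma mulr_smooth_at (a k g h : G) : dom (ch a) g -> dom (ch k) (g * h)%g ->
  smooth_at (fun u : lie => coord (ch k) (uncoord (ch a) u * h)%g)
    (coord (ch a) g).
Proof.
move=> ag kgh; have hh := mem_chart_at ch h.
have := smooth_at_comp (f := fun u : lie => (u, coord (ch h) h))
  (findim_prod (findim_mx _ _) (findim_mx _ _)) _ (mul_smooth_at ag hh kgh).
rewrite /= coordK//; apply.
by apply: smooth_at_pair; [exact: smooth_at_id|exact: smooth_at_cst].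
Qed.

Lemma mul_continuous_at (g h : G) :
  (z.1 * z.2)%g @[z --> (g, h)] --> (g * h)%g.
Proof. by case: (lie_mul_smooth G) => mc _; exact: (mc (g, h)). Qed.

Lemma inv_continuous_at (g : G) : (h^-1)%g @[h --> g] --> (g^-1)%g.
Proof. by case: (lie_inv_smooth G) => ic _; exact: ic. Qed.

Lemma mulr_continuous_at (g h : G) : (k * h)%g @[k --> g] --> (g * h)%g.
Proof.
have pc : (k, h) @[k --> g] --> (g, h).
  by apply: cvg_pair; [exact: cvg_id|exact: cvg_cst].
exact: cvg_comp pc (@mul_continuous_at g h).
Qed.

Lemma mulr_mdifferentiable (g h : G) :
  mdifferentiable ch ch (fun k : G => (k * h)%g) g.
Proof.
split; first exact: mulr_continuous_at.
apply: smooth_at_differentiable.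
by apply: mulr_smooth_at; exact: mem_chart_at.
Qed.

Lemma TRVK (g : G) (w : lie) : TRV g (TeR g w) = w.
Proof.
(* The chain rule puts the outer tangent map at the image point [1 * g], which equals [g] only after
   rewriting. All tangent spaces being the same model space, the statement stays well typed. *)
have E : tangent_map ch ch (fun h : G => h * g^-1)%g (1 * g)%g (TeR g w) =
    tangent_map ch ch ((fun h : G => h * g^-1) \o (fun h : G => h * g))%g 1%g w.
  rewrite (@tangent_map_comp _ _ _ _ _ _ _ ch ch ch)//;
    exact: mulr_mdifferentiable.
have gK : ((fun h : G => h * g^-1) \o (fun h : G => h * g))%g = id.
  by apply: funext => h /=; rewrite mulgK.
by rewrite mul1g gK tangent_map_id in E.
Qed.

Lemma TeRK (g : G) (v : lie) : TeR g (TRV g v) = v.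
Proof.
have E : tangent_map ch ch (fun h : G => h * g)%g (g * g^-1)%g (TRV g v) =
    tangent_map ch ch ((fun h : G => h * g) \o (fun h : G => h * g^-1))%g g v.
  rewrite (@tangent_map_comp _ _ _ _ _ _ _ ch ch ch)//;
    exact: mulr_mdifferentiable.
have gK : ((fun h : G => h * g) \o (fun h : G => h * g^-1))%g = id.
  by apply: funext => h /=; rewrite mulgVK.
by rewrite mulgV gK tangent_map_id in E.
Qed.

(** Conjugation is the product of [x * y] and [x^-1]. The composite of the local expressions passes
    through the chart twice, and agrees with conjugation near the identity, where these two values
    lie in the domain of [c1]. *)
Lemma conj_smooth_at : smooth_at (fun u : lie * lie => coord c1
  (uncoord c1 u.1 * uncoord c1 u.2 * (uncoord c1 u.1)^-1)%g) (x0, x0).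
Proof.
have d1 := mem_chart_at ch (1%g : G).
have d11 : dom c1 (1 * 1)%g by rewrite mulg1.
have dV : dom c1 (1^-1)%g by rewrite invg1.
have fd : findim (lie * lie)%type := findim_prod (findim_mx 1 n) (findim_mx 1 n).
have sm := mul_smooth_at d1 d1 d11.
have si : smooth_at (fun u : lie => coord c1 (uncoord c1 u)^-1%g) x0.
  exact: smooth_local (lie_inv_smooth G) d1 dV.
have si1 := smooth_at_comp (findim_mx 1 n) (smooth_at_fst (x0, x0)) si.
have := smooth_at_comp (f := fun u : lie * lie =>
  (coord c1 (uncoord c1 u.1 * uncoord c1 u.2)%g,
   coord c1 (uncoord c1 u.1)^-1%g)) fd (smooth_at_pair sm si1).
rewrite /= !coordK// !mulg1 invg1 => /(_ _ _ sm); apply: smooth_at_near.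
have uc := @uncoord_continuous_at _ _ _ ch (1%g : G).
have d1n : nbhs (1%g : G) (dom c1) by apply: open_nbhs_nbhs; split=> //; exact: open_dom.
have u1 : uncoord c1 z.1 @[z --> (x0, x0)] --> (1%g : G).
  exact: cvg_comp (@cvg_fst _ _ (nbhs x0) (nbhs x0) _) uc.
have u2 : uncoord c1 z.2 @[z --> (x0, x0)] --> (1%g : G).
  exact: cvg_comp (@cvg_snd _ _ (nbhs x0) (nbhs x0) _) uc.
near=> z => /=; rewrite !coordK//; near: z.
  have := cvg_comp _ _ u1 (@inv_continuous_at 1%g).
  by rewrite invg1; apply.
have := cvg_comp _ _ (cvg_pair u1 u2) (@mul_continuous_at 1%g 1%g).
by rewrite mulg1; apply.
Unshelve. all: by end_near. Qed.

End LieGroupCalculus.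

(** * The adjoint action and antisymmetry of the bracket *)

Section Adjoint.
Context {R : realType} {n : nat} (G : lieGroup R n).
Local Notation lie := 'rV[R]_n.
Local Notation ch := (lie_atlas G).
Local Notation c1 := (lie_atlas G 1%g).

Let findim_lie2 : findim (lie * lie)%type.
Proof. exact: findim_prod (findim_mx 1 n) (findim_mx 1 n). Qed.

Lemma is_diff_pairl (x y : lie) :
  is_diff x (fun z => (z, y)) (fun v => (v, 0 : lie)).
Proof. exact: is_diff_pair. Qed.

Lemma is_diff_pairr (x y : lie) :
  is_diff y (fun z => (x, z)) (fun v => (0 : lie, v)).
Proof. exact: is_diff_pair. Qed.

Lemma smooth_at_pairl (x y : lie) : smooth_at (fun z => (z, y)) x.
Proof. by apply: smooth_at_pair; [exact: smooth_at_id|exact: smooth_at_cst]. Qed.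

Lemma smooth_at_pairr (x y : lie) : smooth_at (fun z => (x, z)) y.
Proof. by apply: smooth_at_pair; [exact: smooth_at_cst|exact: smooth_at_id]. Qed.

(* With m the multiplication and c the conjugation (x, y) |-> x y x^-1 in a chart
   around e = x0, the identity c (x, y) x = x y is differentiated in y at e, then
   in x at e. *)
Lemma diff_conjugation (m c : lie * lie -> lie) (x0 eta : lie) (A dA : lie -> lie) :
  smooth_at m (x0, x0) -> smooth_at c (x0, x0) -> (forall x, c (x, x0) = x0) ->
  {near (x0, x0), (fun z => m (c z, z.1)) =1 m} ->
  (forall v, 'd m (x0, x0) (v, 0) = v) ->
  (\forall x \near x0, 'd c (x, x0) (0, eta) = A x) -> A x0 = eta ->
  is_diff x0 A dA ->
  forall xi, dA xi = 'd (fun z => 'd m z (0, eta)) (x0, x0) (xi, 0) -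
    'd (fun z => 'd m z (0, xi)) (x0, x0) (eta, 0).
Proof.
move=> sm sc cx0 conj_mul dm1 cA Ax0 dAx xi.
have pl := smooth_at_continuous (smooth_at_pairl x0 x0).
have pr := smooth_at_continuous (smooth_at_pairr x0 x0).
have dm := smooth_at_near_differentiable sm.
have dc := smooth_at_near_differentiable sc.
(* Derivative in [y] at [x0] of [c (x, y) x = x y], for each [x] near [x0]. Since [c (x, x0) = x0],
   the outer derivative of [m] sits at [(x0, x)]: [x] has moved to the second slot. *)
have key : {near x0, (fun x => 'd m (x0, x) (A x, 0)) =1
    (fun x => 'd m (x, x0) (0, eta))}.
  near=> x.
  have dcx : is_diff (x, x0) c ('d c (x, x0)).
    by apply: differentiableP; near: x; exact: pl dc.
  have dmx : is_diff (c (x, x0), x) m ('d m (x0, x)).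
    by rewrite cx0; apply: differentiableP; near: x; exact: pr dm.
  have dcm := is_diff_comp (is_diff_pair dcx (is_diff_fst (x, x0))) dmx.
  have cm : {near (x, x0), (fun z => m (c z, z.1)) =1 m}.
    by near: x; exact: pl (near_join conj_mul).
  have dmx0 : is_diff (x, x0) m (fun y => 'd m (x0, x) ('d c (x, x0) y, y.1)).
    by apply: (is_diff_near cm); exact: dcm.
  have [_ dmE] := dmx0.
  have cAx : 'd c (x, x0) (0, eta) = A x by near: x; exact: cA.
  by rewrite -cAx; exact: esym (congr1 (fun h => h (0, eta)) dmE).
have dw : is_diff x0 (fun x => (A x, 0 : lie)) (fun xi => (dA xi, 0)).
  exact: is_diff_pair dAx (is_diff_cst _ _).
have [_ lhs] := is_diff_comp (is_diff_pairl x0 x0)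
  (differentiableP (smooth_at_differentiable (smooth_at_diff (0, eta) sm))).
have [_ rhs] := is_diff_near key
  (is_diff_dapp findim_lie2 sm (is_diff_pairr x0 x0) dw).
pose D v w : lie := 'd (fun z => 'd m z v) (x0, x0) w.
(* Derivative of [key] in [x]: on the right, one term from the moving base point and one from the
   moving direction [A x]. *)
have DE : D (0, eta) (xi, 0) = D (A x0, 0) (0, xi) + 'd m (x0, x0) (dA xi, 0).
  exact: etrans (esym (congr1 (fun h => h xi) lhs)) (congr1 (fun h => h xi) rhs).
(* The base point term differentiates the two slots in the order opposite to the one wanted; this is
   the only use of the symmetry of the second derivative. *)
have DC : D (eta, 0) (0, xi) = D (0, xi) (eta, 0).
  exact: schwarz (findim_mx 1 n) sm.
apply: (etrans (y := D (0, eta) (xi, 0) - D (0, xi) (eta, 0))) => //.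
by rewrite DE Ax0 DC (dm1 (dA xi)) addrC addKr.
Unshelve. all: by end_near. Qed.

Local Notation x0 := (coord c1 1%g).

Let mul1 (u : lie * lie) : lie :=
  coord c1 (uncoord c1 u.1 * uncoord c1 u.2)%g.
Let conj1 (u : lie * lie) : lie :=
  coord c1 (uncoord c1 u.1 * uncoord c1 u.2 * (uncoord c1 u.1)^-1)%g.

Let d1 : dom c1 (1%g : G).
Proof. exact: mem_chart_at. Qed.

Let mul1_smooth : smooth_at mul1 (x0, x0).
Proof. by apply: mul_smooth_at => //; rewrite mulg1. Qed.

Let conj1_smooth : smooth_at conj1 (x0, x0).
Proof. exact: conj_smooth_at. Qed.

Let conj1x x : conj1 (x, x0) = x0.
Proof. by rewrite /conj1 /= coordK// mulg1 mulgV. Qed.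

(** The target chart in [Ad g] is the one preferred at [g * 1 * g^-1]; the group laws identify it
    with [c1]. *)
Lemma Ad_uncoordE x eta :
  Ad (uncoord c1 x : G) eta = 'd (fun y => conj1 (x, y)) x0 eta.
Proof.
rewrite /Ad /tangent_map /local_rep; set g := uncoord c1 x.
by rewrite mulg1 mulgV.
Qed.

Lemma Ad_near eta :
  \forall x \near x0, 'd conj1 (x, x0) (0, eta) = Ad (uncoord c1 x : G) eta.
Proof.
have cx : {for x0, continuous (fun z : lie => (z, x0))}.
  exact: smooth_at_continuous (smooth_at_pairl _ _).
have : \forall x \near x0, differentiable conj1 (x, x0).
  exact: cx _ (smooth_at_near_differentiable conj1_smooth).
apply: filterS => x /differentiableP dF; rewrite Ad_uncoordE.
by have [_ ->] := is_diff_comp (is_diff_pairr x x0) dF.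
Qed.

Lemma Ad_smooth eta : smooth_at (fun x => Ad (uncoord c1 x : G) eta) x0.
Proof.
apply: (smooth_at_near (f := fun x => 'd conj1 (x, x0) (0, eta))).
  exact: Ad_near.
exact: smooth_at_comp findim_lie2 (smooth_at_pairl x0 x0)
  (smooth_at_diff (0, eta) conj1_smooth).
Qed.

(** Smoothness of [Ad] near the identity guarantees that [ad], defined through ['d], is a true
    derivative. *)
Lemma is_diff_Ad eta :
  is_diff x0 (fun x => Ad (uncoord c1 x : G) eta) (fun xi => ad G xi eta).
Proof. by apply/differentiableP/smooth_at_differentiable; exact: Ad_smooth. Qed.

Lemma Ad_linear (g : G) : linear (Ad g).
Proof. by move=> k a b; rewrite /Ad /tangent_map linearP. Qed.

(** In the first argument [ad] is linear as a derivative is in its direction; in the second,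
    linearity is inherited from each [Ad g] by differentiating at the identity. *)
Lemma ad_linearr xi : linear (ad G xi).
Proof.
move=> k a b.
have AdP : (fun x => Ad (uncoord c1 x : G) (k *: a + b)) =
    k *: (fun x => Ad (uncoord c1 x : G) a) + (fun x => Ad (uncoord c1 x : G) b).
  by apply: funext => x; exact: Ad_linear.
have [_] := is_diff_Ad (k *: a + b); rewrite AdP.
have [_ ->] := is_diffD (is_diffZ k (is_diff_Ad a)) (is_diff_Ad b).
by move=> /(congr1 (fun h => h xi)).
Qed.

Lemma ad_linearl eta : linear (fun xi => ad G xi eta).
Proof. by move=> k a b; rewrite /ad /tangent_map linearP. Qed.

Let Ad1 eta : Ad (uncoord c1 x0 : G) eta = eta.
Proof.
rewrite coordK// -[RHS](tangent_map_id ch (1%g : G)).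
have cE : (fun h : G => 1 * h * 1^-1)%g = id.
  by apply: funext => h; rewrite mul1g invg1 mulg1.
by rewrite /Ad cE.
Qed.

Let diff_mul1l v : 'd mul1 (x0, x0) (v, 0) = v.
Proof.
have dm := differentiableP (smooth_at_differentiable mul1_smooth).
have [_ /(congr1 (fun h => h v))/= <-] := is_diff_comp (is_diff_pairl x0 x0) dm.
(* Right multiplication by the identity is the identity in the chart, but only near [x0], where
   [coord] undoes [uncoord]. *)
have [_ ->] : is_diff x0 (mul1 \o (fun z => (z, x0))) id => //.
apply: is_diff_near (is_diff_id _).
apply: filterS (uncoordK d1) => x uK /=.
by rewrite /mul1 /= (coordK d1) mulg1 uK.
Qed.

Let beta xi eta := 'd (fun z => 'd mul1 z (0, eta)) (x0, x0) (xi, 0).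

(** It remains to see that [(x y x^-1) x = x y] holds in the chart: this requires the conjugate to
    stay in the domain of [c1], which continuity of the group operations gives near the identity. *)
Lemma ad_hessian xi eta : ad G xi eta = beta xi eta - beta eta xi.
Proof.
have conj_mul : {near (x0, x0), (fun z => mul1 (conj1 z, z.1)) =1 mul1}.
  have uc := @uncoord_continuous_at _ _ _ ch (1%g : G).
  have u1 : uncoord c1 z.1 @[z --> (x0, x0)] --> (1%g : G).
    exact: cvg_comp (@cvg_fst _ _ (nbhs x0) (nbhs x0) _) uc.
  have u2 : uncoord c1 z.2 @[z --> (x0, x0)] --> (1%g : G).
    exact: cvg_comp (@cvg_snd _ _ (nbhs x0) (nbhs x0) _) uc.
  have u12 : (uncoord c1 z.1 * uncoord c1 z.2)%g @[z --> (x0, x0)] --> (1%g : G).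
    have := cvg_comp _ _ (cvg_pair u1 u2) (@mul_continuous_at _ _ G 1%g 1%g).
    by rewrite mulg1; exact.
  have u1V : (uncoord c1 z.1)^-1%g @[z --> (x0, x0)] --> (1%g : G).
    have := cvg_comp _ _ u1 (@inv_continuous_at _ _ G 1%g).
    by rewrite invg1; exact.
  have uF : (uncoord c1 z.1 * uncoord c1 z.2 * (uncoord c1 z.1)^-1)%g
      @[z --> (x0, x0)] --> (1%g : G).
    have := cvg_comp _ _ (cvg_pair u12 u1V) (@mul_continuous_at _ _ G 1%g 1%g).
    by rewrite mulg1; exact.
  have : \forall z \near (x0, x0),
      dom c1 (uncoord c1 z.1 * uncoord c1 z.2 * (uncoord c1 z.1)^-1)%g.
    by apply: uF; apply: open_nbhs_nbhs; split=> //; exact: open_dom.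
  by apply: filterS => z zd; rewrite /mul1 /= coordK// mulgVK.
exact: diff_conjugation mul1_smooth conj1_smooth conj1x conj_mul
  diff_mul1l (Ad_near eta) (Ad1 eta) (is_diff_Ad eta) xi.
Qed.

Lemma ad_antisym xi eta : ad G eta xi = - ad G xi eta.
Proof. by rewrite !ad_hessian opprB. Qed.

End Adjoint.

(** * Duality *)

Section Duality.
Context {R : realType}.

Lemma linear_findim_continuous (E F : normedModType R) (f : E -> F) :
  findim E -> linear f -> continuous f.
Proof.
move=> [I [e [p [lp cp pE]]]] lf x.
pose fL : {linear E -> F} := HB.pack f (GRing.isLinear.Build _ _ _ _ _ lf).
apply: smooth_at_continuous.
have := smooth_at_sum (fun i => smooth_at_scale
  (smooth_at_linear x (lp i) (cp i)) (smooth_at_cst (f (e i)) x)).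
apply: smooth_at_near; apply: nearW => y; rewrite [in RHS](pE y).
by rewrite -[f]/(fL : _ -> _) linear_sum; apply: eq_bigr => i _; rewrite linearZ.
Qed.

Lemma smooth_at_mx (E : normedModType R) m n (f : E -> 'M[R]_(m, n)) (x : E) :
  (forall i j, smooth_at (fun y => f y i j : R^o) x) -> smooth_at f x.
Proof.
move=> sf; have := smooth_at_sum (fun i => smooth_at_sum (fun j =>
  smooth_at_scale (sf i j) (smooth_at_cst (delta_mx i j : 'M[R]_(m, n)) x))).
by apply: smooth_at_near; apply: nearW => y; rewrite -matrix_sum_delta.
Qed.

Lemma smooth_at_coord (E : normedModType R) m n (f : E -> 'M[R]_(m, n)) (x : E) i j :
  smooth_at f x -> smooth_at (fun y => f y i j : R^o) x.
Proof.
apply: (smooth_at_post_linear (l := fun v : 'M[R]_(m, n) => v i j : R^o)).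
  exact: linear_coord.
exact: coord_continuous.
Qed.

Context {n : nat}.
Local Notation lie := 'rV[R]_n.
Local Notation dual := 'cV[R]_n.

Lemma pairingE (mu : dual) (xi : lie) : pairing mu xi = \sum_i xi 0 i * mu i 0.
Proof. by rewrite /pairing mxE. Qed.

Lemma pairingDl (mu nu : dual) (xi : lie) :
  pairing (mu + nu) xi = pairing mu xi + pairing nu xi.
Proof. by rewrite /pairing mulmxDr mxE. Qed.

Lemma pairingNl (mu : dual) (xi : lie) : pairing (- mu) xi = - pairing mu xi.
Proof. by rewrite /pairing mulmxN mxE. Qed.

Lemma pairing0l (xi : lie) : pairing 0 xi = 0.
Proof. by rewrite /pairing mulmx0 mxE. Qed.

Lemma pairingDr (mu : dual) (xi eta : lie) :
  pairing mu (xi + eta) = pairing mu xi + pairing mu eta.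
Proof. by rewrite /pairing mulmxDl mxE. Qed.

Lemma pairingZr k (mu : dual) (xi : lie) : pairing mu (k *: xi) = k * pairing mu xi.
Proof. by rewrite /pairing -scalemxAl mxE. Qed.

Lemma pairing0r (mu : dual) : pairing mu 0 = 0.
Proof. by rewrite /pairing mul0mx mxE. Qed.

Lemma pairing_deltar (mu : dual) i : pairing mu (delta_mx 0 i) = mu i 0.
Proof. by rewrite /pairing -rowE mxE. Qed.

Lemma pairing_deltal (xi : lie) i : pairing (delta_mx i 0) xi = xi 0 i.
Proof. by rewrite /pairing -colE mxE. Qed.

Lemma pairing_injl (mu nu : dual) :
  (forall xi, pairing mu xi = pairing nu xi) -> mu = nu.
Proof.
move=> e; apply/colP => i; have := e (delta_mx 0 i).
by rewrite !pairing_deltar.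
Qed.

Lemma pairing_injr (xi eta : lie) :
  (forall mu, pairing mu xi = pairing mu eta) -> xi = eta.
Proof.
move=> e; apply/rowP => i; have := e (delta_mx i 0).
by rewrite !pairing_deltal.
Qed.

Lemma pairing_covector (f : lie -> R^o) xi : linear f ->
  pairing (covector f) xi = f xi.
Proof.
move=> lf; pose fL : {linear lie -> R^o} :=
  HB.pack f (GRing.isLinear.Build _ _ _ _ _ lf).
rewrite pairingE [in RHS](row_sum_delta xi) -[f]/(fL : _ -> _) linear_sum.
by apply: eq_bigr => i _; rewrite linearZ mxE.
Qed.

Lemma pairing_vector_of (f : dual -> R^o) mu : linear f ->
  pairing mu (vector_of f) = f mu.
Proof.
move=> lf; pose fL : {linear dual -> R^o} :=
  HB.pack f (GRing.isLinear.Build _ _ _ _ _ lf).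
rewrite pairingE [in RHS](matrix_sum_delta mu) -[f]/(fL : _ -> _) linear_sum.
apply: eq_bigr => i _; rewrite big_ord1 linearZ mxE.
by rewrite [RHS]mulrC.
Qed.

Lemma smooth_at_covector (E : normedModType R) (f : E -> lie -> R^o) (x : E) :
  (forall v, smooth_at (fun y => f y v) x) ->
  smooth_at (fun y => covector (f y)) x.
Proof.
move=> sf; apply: smooth_at_mx => i j; under eq_fun do rewrite mxE.
exact: sf.
Qed.

Lemma smooth_at_vector_of (E : normedModType R) (f : E -> dual -> R^o) (x : E) :
  (forall v, smooth_at (fun y => f y v) x) ->
  smooth_at (fun y => vector_of (f y)) x.
Proof.
move=> sf; apply: smooth_at_mx => i j; under eq_fun do rewrite mxE.
exact: sf.
Qed.

Lemma smooth_at_pairing (E : normedModType R) (f : E -> dual) (g : E -> lie) (x : E) :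
  smooth_at f x -> smooth_at g x ->
  smooth_at (fun y => pairing (f y) (g y) : R^o) x.
Proof.
move=> sf sg; under eq_fun do rewrite pairingE.
apply: (@smooth_at_sum _ _ R^o _ (fun i y => g y 0 i * f y i 0)) => i.
by apply: (@smooth_at_scale _ _ R^o); exact: smooth_at_coord.
Qed.

Context (G : lieGroup R n).

(** [covector] samples its form on the basis only; linearity of [ad] in its second argument recovers
    the pairing with every vector. *)
Lemma pairing_coad (xi eta : lie) (mu : dual) :
  pairing (coad G xi mu) eta = - pairing mu (ad G xi eta).
Proof.
rewrite pairing_covector// => k a b.
by rewrite ad_linearr pairingDr pairingZr opprD -mulrN.
Qed.

Lemma coadD (xi : lie) (mu nu : dual) :
  coad G xi (mu + nu) = coad G xi mu + coad G xi nu.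
Proof.
by apply: pairing_injl => eta; rewrite pairingDl !pairing_coad pairingDl opprD.
Qed.

Lemma coadN (xi : lie) (mu : dual) : coad G xi (- mu) = - coad G xi mu.
Proof.
by apply: pairing_injl => eta; rewrite pairingNl !pairing_coad pairingNl.
Qed.

Lemma smooth_at_coad (E : normedModType R) (f : E -> lie) (h : E -> dual) (x : E) :
  smooth_at f x -> smooth_at h x -> smooth_at (fun y => coad G (f y) (h y)) x.
Proof.
move=> sf sh; apply: smooth_at_covector => v; apply: smooth_atN.
apply: smooth_at_pairing => //.
apply: (smooth_at_post_linear (l := fun xi => ad G xi v)) sf.
  exact: ad_linearl.
by apply: linear_findim_continuous; [exact: findim_mx|exact: ad_linearl].
Qed.

Lemma TeR_linear (g : G) : linear (TeR g).
Proof. by move=> k a b; rewrite /TeR /tangent_map linearP. Qed.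

Lemma TRV0 (g : G) : TRV g 0 = 0.
Proof. by rewrite /TRV /tangent_map linear0. Qed.

Lemma ad0r (xi : lie) : ad G xi 0 = 0.
Proof. by have := ad_linearr G xi (-1) 0 0; rewrite scaler0 addr0 scaleN1r addNr. Qed.

Lemma pairing_coTeR (g : G) (alpha : dual) xi :
  pairing (coTeR g alpha) xi = pairing alpha (TeR g xi).
Proof.
rewrite pairing_covector// => k a b.
by rewrite TeR_linear pairingDr pairingZr.
Qed.

End Duality.

(** * The Hamiltonian vector field *)

Section Velocity.
Context {R : realType}.

(** The preferred chart at a pair is the product of the preferred charts, so velocities split;
    applied repeatedly, it separates Hamilton's equations into four. *)
Lemma has_velocity_prod (E F : normedModType R) (M N : topologicalType)
    (A : atlas E M) (B : atlas F N) (c : R^o -> M) (d : R^o -> N) (t : R)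
    (v : E) (w : F) :
  has_velocity (prod_atlas A B) (fun s => (c s, d s)) t (v, w) <->
  has_velocity A c t v /\ has_velocity B d t w.
Proof.
pose cr (s : R^o) := coord (A (c t)) (c s).
pose dr (s : R^o) := coord (B (d t)) (d s).
split=> [[[cc dc] vw]|[[[cc dc] vE] [[cd dd] wE]]].
  have cdd : is_diff (t : R^o) (fun s => (cr s, dr s))
      ('d (fun s => (cr s, dr s)) t).
    exact: differentiableP dc.
  have vwE : 'd (fun s => (cr s, dr s)) t 1 = (v, w) by exact: vw.
  have [c1 c2] := is_diff_comp cdd (is_diff_fst (cr t, dr t)).
  have [d1 d2] := is_diff_comp cdd (is_diff_snd (cr t, dr t)).
  have ccd : (c s, d s) @[s --> (t : R^o)] --> (c t, d t) by exact: cc.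
  split; split.
  - by split; [exact: cvg_comp ccd (@cvg_fst _ _ (nbhs (c t)) (nbhs (d t)) _)|exact: c1].
  - exact: etrans (congr1 (fun h => h 1) c2) (congr1 fst vwE).
  - by split; [exact: cvg_comp ccd (@cvg_snd _ _ (nbhs (c t)) (nbhs (d t)) _)|exact: d1].
  - exact: etrans (congr1 (fun h => h 1) d2) (congr1 snd vwE).
have [p1 p2] : is_diff (t : R^o) (fun s => (cr s, dr s))
    (fun s => ('d cr t s, 'd dr t s)).
  by apply: is_diff_pair; apply: differentiableP; [exact: dc|exact: dd].
split; first by split; [exact: cvg_pair cc cd|exact: p1].
apply: etrans (congr1 (fun h => h 1) p2) _.
by apply/pair_equal_spec; split; [exact: vE|exact: wE].
Qed.

Lemma has_velocity_id (E : normedModType R) (c : R^o -> E) (t : R) (v : E) :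
  has_velocity (id_atlas E) c t v <-> is_derive (t : R^o) 1 c v.
Proof.
split=> [[[_ dc] vE]|[dc cE]].
  split; first by apply: diff_derivable; exact: dc.
  by rewrite deriveE; [exact: vE|exact: dc].
have cd : differentiable c (t : R^o) by apply/derivable1_diffP.
split; first by split; [exact: differentiable_continuous|exact: cd].
by rewrite -cE deriveE.
Qed.

End Velocity.

(** * The energy in a fixed chart and its partial derivatives *)

Section PartialDerivatives.
Context {R : realType} {n : nat} (G : lieGroup R n).
Variables (E : TTG G -> R^o) (E_smooth : smooth (tt_atlas G) (id_atlas R^o) E).
Local Notation lie := 'rV[R]_n.
Local Notation dual := 'cV[R]_n.
Local Notation ch := (lie_atlas G).
Local Notation model := ((lie * dual) * (lie * dual))%type.
Local Notation x0 := (coord (ch 1%g) 1%g).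

(** The chart is fixed at [k] and does not follow the point, so that derivatives can be compared at
    different points. *)
Definition chart_rep (k : G) (u : model) : R^o :=
  E ((uncoord (ch k) u.1.1, u.1.2), (u.2.1, u.2.2)).

Section AtPoint.
Variables (k g : G) (mu : dual) (xi : lie) (nu : dual).
Hypothesis kg : dom (ch k) g.
Let p : TTG G := ((g, mu), (xi, nu)).
Let u : model := ((coord (ch k) g, mu), (xi, nu)).

Lemma chart_rep_smooth : smooth_at (chart_rep k) u.
Proof.
(* Only [k] selects a chart here; the zeros are placeholders, as [id_atlas] has the same chart at
   every point. *)
exact: (@smooth_local _ _ _ _ _ _ _ _ (((k, 0), (0, 0)) : TTG G) p 0 E_smooth).
Qed.

Let dE : is_diff u (chart_rep k) ('d (chart_rep k) u).
Proof. by apply/differentiableP/smooth_at_differentiable; exact: chart_rep_smooth. Qed.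

Lemma delta_muE :
  delta_mu E p = vector_of (fun m => 'd (chart_rep k) u ((0, m), (0, 0))).
Proof.
have inj : is_diff mu (fun m => ((coord (ch k) g, m), (xi, nu)) : model)
  (fun m => ((0, m), (0, 0))).
  exact: is_diff_pair (is_diff_pair (is_diff_cst (coord (ch k) g) mu)
    (is_diff_id mu)) (is_diff_cst (xi, nu) mu).
have [_ dmE] : is_diff mu (fun m => E ((g, m), (xi, nu)))
    (fun m => 'd (chart_rep k) u ((0, m), (0, 0))).
  apply: is_diff_ext (is_diff_comp inj dE) => m.
  by rewrite /chart_rep /= coordK.
exact (congr1 (@vector_of R n) dmE).
Qed.

Lemma delta_nuE :
  delta_nu E p = vector_of (fun m => 'd (chart_rep k) u ((0, 0), (0, m))).
Proof.
have inj : is_diff nu (fun m => ((coord (ch k) g, mu), (xi, m)) : model)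
  (fun m => ((0, 0), (0, m))).
  exact: is_diff_pair (is_diff_cst (coord (ch k) g, mu) nu)
    (is_diff_pair (is_diff_cst xi nu) (is_diff_id nu)).
have [_ dmE] : is_diff nu (fun m => E ((g, mu), (xi, m)))
    (fun m => 'd (chart_rep k) u ((0, 0), (0, m))).
  apply: is_diff_ext (is_diff_comp inj dE) => m.
  by rewrite /chart_rep /= coordK.
exact (congr1 (@vector_of R n) dmE).
Qed.

Lemma delta_xiE :
  delta_xi E p = covector (fun x => 'd (chart_rep k) u ((0, 0), (x, 0))).
Proof.
have inj : is_diff xi (fun x => ((coord (ch k) g, mu), (x, nu)) : model)
  (fun x => ((0, 0), (x, 0))).
  exact: is_diff_pair (is_diff_cst (coord (ch k) g, mu) xi)
    (is_diff_pair (is_diff_id xi) (is_diff_cst nu xi)).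
have [_ dmE] : is_diff xi (fun x => E ((g, mu), (x, nu)))
    (fun x => 'd (chart_rep k) u ((0, 0), (x, 0))).
  apply: is_diff_ext (is_diff_comp inj dE) => m.
  by rewrite /chart_rep /= coordK.
exact (congr1 (@covector R n) dmE).
Qed.

End AtPoint.

(** Unlike the other partial derivatives, [delta_g] is a covector written in the chart preferred at
    [g], so the chart representation is taken at [g] itself. *)
Lemma delta_gE (g : G) (mu : dual) (xi : lie) (nu : dual) :
  delta_g E ((g, mu), (xi, nu)) = covector (fun v =>
    'd (chart_rep g) ((coord (ch g) g, mu), (xi, nu)) ((v, 0), (0, 0))).
Proof.
set u : model := ((_, _), _).
have dE : is_diff u (chart_rep g) ('d (chart_rep g) u).
  apply/differentiableP/smooth_at_differentiable; apply: chart_rep_smooth.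
  exact: mem_chart_at.
have inj : is_diff (coord (ch g) g) (fun x => ((x, mu), (xi, nu)) : model)
  (fun x => ((x, 0), (0, 0))).
  exact: is_diff_pair (is_diff_pair (is_diff_id _) (is_diff_cst mu _))
    (is_diff_cst (xi, nu) _).
have [_ dmE] := is_diff_comp inj dE.
exact (congr1 (@covector R n) dmE).
Qed.

Lemma linear_form_partials (D : {linear model -> R^o}) (a : lie) (b : dual)
    (x : lie) (m : dual) :
  D ((a, b), (x, m)) =
    pairing (covector (fun v => D ((v, 0), (0, 0)))) a +
    pairing b (vector_of (fun v => D ((0, v), (0, 0)))) +
    pairing (covector (fun v => D ((0, 0), (v, 0)))) x +
    pairing m (vector_of (fun v => D ((0, 0), (0, v)))).
Proof.
have lin (V : normedModType R) (i : V -> model) : linear i ->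
    linear (fun v => D (i v)).
  by move=> li y v w; rewrite li linearP.
have pe (y y' : lie) (b0 b' : dual) (x1 x' : lie) (m0 m' : dual) :
  ((y, b0), (x1, m0)) + ((y', b'), (x', m')) =
    ((y + y', b0 + b'), (x1 + x', m0 + m')) :> model.
  by [].
have ps k (y : lie) (b0 : dual) (x1 : lie) (m0 : dual) :
  k *: ((y, b0), (x1, m0)) = ((k *: y, k *: b0), (k *: x1, k *: m0)) :> model by [].
rewrite !pairing_covector ?pairing_vector_of;
  try by apply: lin => y v w; rewrite ps pe !scaler0 !addr0.
have -> : ((a, b), (x, m)) = ((a, 0), (0, 0)) + ((0, b), (0, 0)) +
    ((0, 0), (x, 0)) + ((0, 0), (0, m)) :> model.
  by rewrite !pe !addr0 !add0r.
by rewrite !linearD.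
Qed.

Lemma tangent_map_partials (g : G) (mu : dual) (xi : lie) (nu : dual)
    (a : lie) (b : dual) (x : lie) (m : dual) :
  let p : TTG G := ((g, mu), (xi, nu)) in
  tangent_map (tt_atlas G) (id_atlas R^o) E p ((a, b), (x, m)) =
    pairing (delta_g E p) a + pairing b (delta_mu E p) +
    pairing (delta_xi E p) x + pairing m (delta_nu E p).
Proof.
move=> p; have gg := mem_chart_at ch g.
rewrite (delta_muE mu xi nu gg) (delta_nuE mu xi nu gg)
  (delta_xiE mu xi nu gg) delta_gE.
exact: linear_form_partials.
Qed.

End PartialDerivatives.

(** * Pointwise solution of Hamilton's equation and changes of chart *)

Section HamiltonianField.
Context {R : realType} {n : nat} (G : lieGroup R n).
Local Notation lie := 'rV[R]_n.
Local Notation dual := 'cV[R]_n.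
Local Notation ch := (lie_atlas G).
Local Notation model := ((lie * dual) * (lie * dual))%type.
Local Notation x0 := (coord (ch 1%g) 1%g).

Lemma tulczyjew_nondegenerate (p : TTG G) (V W : tangent (tt_atlas G) p) :
  (forall Y, tulczyjew V Y = tulczyjew W Y) -> V = W.
Proof.
case: p V W => [[g mu] [xi nu]] [[a b] [x m]] [[a' b'] [x' m']] VW.
have aE : TRV g a = TRV g a'.
  apply: pairing_injr => c; have := VW ((0, 0), (0, c)).
  rewrite /= TRV0 !ad0r !pairing0r !pairing0l !sub0r !addr0 !subr0.
  exact: oppr_inj.
have xE : x = x'.
  apply: pairing_injr => c; have := VW ((0, c), (0, 0)).
  rewrite /= TRV0 !ad0r !pairing0r !pairing0l !sub0r !oppr0 !add0r.
  exact: oppr_inj.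
have bE : b = b'.
  apply: pairing_injl => c; have := VW ((0, 0), (c, 0)).
  by rewrite /= TRV0 !ad0r !pairing0r !pairing0l !sub0r !oppr0 !add0r !addr0.
(* Testing along [TeR g c] leaves the bracket term [pairing nu (ad a c)] next to [pairing m c];
   [aE], proved beforehand, makes it the same on both sides. *)
have mE : m = m'.
  apply: pairing_injl => c; have := VW ((TeR g c, 0), (0, 0)).
  rewrite /= TRVK aE !pairing0r !pairing0l !subr0 !addr0.
  exact: addIr.
by rewrite -(TeRK g a) -(TeRK g a') aE xE bE mE.
Qed.

Section Field.
Variable E : TTG G -> R^o.

(** Read off by testing Hamilton's equation on one component at a time. The term [coad] in the last
    slot is the bracket term of the form moved to the other side. *)
Definition hamiltonian_field (p : TTG G) : tangent (tt_atlas G) p :=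
  ((TeR p.1.1 (delta_nu E p), - delta_xi E p),
   (delta_mu E p,
    coad G (delta_nu E p) p.2.2 - coTeR p.1.1 (delta_g E p))).

(** The corrections in the generator are exactly what right translation adds back: [coad a mu]
    cancels in the second slot, the two brackets in the third by antisymmetry, and both [coad xi]
    terms in the fourth. *)
Lemma hamiltonian_field_right_invariant (g : G) (mu : dual) (xi : lie) (nu : dual) :
  let p : TTG G := ((g, mu), (xi, nu)) in
  hamiltonian_field p = right_invariant
    ((delta_nu E p,
      - (delta_xi E p + coad G (delta_nu E p) mu)),
     (delta_mu E p + ad G xi (delta_nu E p),
      - (coTeR g (delta_g E p) + coad G xi (delta_xi E p)
         + coad G xi (coad G (delta_nu E p) mu)))) p.
Proof.
move=> p; rewrite /hamiltonian_field /right_invariant /=.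
rewrite coadN coadD (ad_antisym G xi) addrK opprD subrK opprK.
by rewrite -[coTeR _ _ + _ + _]addrA opprD addrAC subrK addrC.
Qed.

Lemma hamiltonian_field_hamiltonian :
  smooth (tt_atlas G) (id_atlas R^o) E -> hamiltonian E hamiltonian_field.
Proof.
move=> sE [[g mu] [xi nu]] [[a b] [x m]].
rewrite (tangent_map_partials sE) /= TRVK.
rewrite pairingDl !pairingNl pairing_coad pairing_coTeR TeRK.
(* [r1] is the bracket term [pairing nu (ad a a')], present once in the form and once, with opposite
   sign, in [coad]; the others are the four terms of the differential. *)
have cancel (r1 r2 r3 r4 r5 : R) :
  - r1 - r2 - r3 + r1 - r4 - r5 = - (r2 + r5 + r4 + r3) by ring.
exact: cancel.
Qed.

Lemma hamiltonian_field_integral_curve (J : set R) (g : R^o -> G)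
    (mu : R^o -> dual) (xi : R^o -> lie) (nu : R^o -> dual) :
  let p := fun t : R^o => ((g t, mu t), (xi t, nu t)) : TTG G in
  integral_curve hamiltonian_field J p <->
  forall t : R^o, J t ->
    [/\ has_velocity (lie_atlas G) g t (TeR (g t) (delta_nu E (p t))),
        is_derive t 1 mu (- delta_xi E (p t)),
        is_derive t 1 xi (delta_mu E (p t)) &
        is_derive t 1 nu (coad G (delta_nu E (p t)) (nu t)
                          - coTeR (g t) (delta_g E (p t)))].
Proof.
move=> p; have velE (t : R) :
    has_velocity (tt_atlas G) p t (hamiltonian_field (p t)) <->
    [/\ has_velocity (lie_atlas G) g t (TeR (g t) (delta_nu E (p t))),
        is_derive (t : R^o) 1 mu (- delta_xi E (p t)),
        is_derive (t : R^o) 1 xi (delta_mu E (p t)) &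
        is_derive (t : R^o) 1 nu (coad G (delta_nu E (p t)) (nu t)
                          - coTeR (g t) (delta_g E (p t)))].
  split.
    move=> /has_velocity_prod[/has_velocity_prod[vg /has_velocity_id vmu]].
    by move=> /has_velocity_prod[/has_velocity_id vxi /has_velocity_id vnu].
  move=> [vg vmu vxi vnu]; apply/has_velocity_prod; split.
    by apply/has_velocity_prod; split=> //; exact/has_velocity_id.
  by apply/has_velocity_prod; split; exact/has_velocity_id.
by split=> vp t Jt; have := vp t Jt => /velE.
Qed.

End Field.

Lemma mulrep_smooth (k g : G) : dom (ch k) g ->
  smooth_at (fun z : lie * lie =>
    coord (ch k) (uncoord (ch 1%g) z.1 * uncoord (ch k) z.2)%g)
    (x0, coord (ch k) g).
Proof.
move=> kg; apply: mul_smooth_at => //; first exact: mem_chart_at.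
by rewrite mul1g.
Qed.

(** Right translation of [w] to the point with coordinate [a], with its components in the fixed
    chart [k]. As a partial derivative of the multiplication it depends smoothly on [a]. *)
Definition TeR_rep (k : G) (a w : lie) : lie :=
  'd (fun z : lie * lie =>
    coord (ch k) (uncoord (ch 1%g) z.1 * uncoord (ch k) z.2)%g) (x0, a) (w, 0).

Lemma is_diff_mulr_rep (k g : G) : dom (ch k) g ->
  is_diff x0 (fun x : lie => coord (ch k) (uncoord (ch 1%g) x * g)%g)
    (TeR_rep k (coord (ch k) g)).
Proof.
move=> kg; have dm := differentiableP (smooth_at_differentiable (mulrep_smooth kg)).
apply: is_diff_ext (is_diff_comp (is_diff_pairl x0 (coord (ch k) g)) dm) => x.
by rewrite /= coordK.
Qed.

Lemma is_diff_TeR (g : G) :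
  is_diff x0 (fun x : lie => coord (ch g) (uncoord (ch 1%g) x * g)%g) (TeR g).
Proof.
have := mdifferentiable_is_diff (mulr_mdifferentiable (1%g : G) g).
by rewrite mul1g.
Qed.

Lemma diff_mulr_curve (H : normedModType R) (phi : G -> H) (k g : G) df dphi :
  dom (ch k) g ->
  is_diff x0 (fun x : lie => coord (ch k) (uncoord (ch 1%g) x * g)%g) df ->
  is_diff (coord (ch k) g) (fun y => phi (uncoord (ch k) y)) dphi ->
  is_diff x0 (fun x : lie => phi (uncoord (ch 1%g) x * g)%g) (dphi \o df).
Proof.
move=> kg dfx dphig; have d1 := mem_chart_at ch (1%g : G).
have rc : {for x0, continuous (fun x => uncoord (ch 1%g) x * g)%g}.
  rewrite /prop_for /continuous_at coordK//.
  have uc := @uncoord_continuous_at _ _ _ ch (1%g : G).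
  exact: (cvg_comp _ _ uc (@mulr_continuous_at _ _ G 1%g g)).
apply: (is_diff_through_chart (c := ch k) rc) => //; rewrite coordK// mul1g//.
Qed.

(** The derivative at the identity of [x |-> coord (ch k) (x * g)] is computed through the chart at
    [g] and then directly in the chart [k]. *)
Lemma TeR_repE (k g : G) (w : lie) : dom (ch k) g ->
  'd (fun y => coord (ch k) (uncoord (ch g) y)) (coord (ch g) g) (TeR g w) =
  TeR_rep k (coord (ch k) g) w.
Proof.
move=> kg; have gg := mem_chart_at ch g.
have tr := differentiableP (smooth_at_differentiable
  (smooth_transition (lie_manifold G) gg kg)).
have [_ e1] := diff_mulr_curve gg (is_diff_TeR g) tr.
have [_ e2] := is_diff_mulr_rep kg.
exact (congr1 (fun h => h w) (etrans (esym e1) e2)).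
Qed.

End HamiltonianField.

(** * Smoothness of the Hamiltonian field *)

Section SmoothField.
Context {R : realType} {n : nat} (G : lieGroup R n).
Variables (E : TTG G -> R^o) (E_smooth : smooth (tt_atlas G) (id_atlas R^o) E).
Local Notation lie := 'rV[R]_n.
Local Notation dual := 'cV[R]_n.
Local Notation ch := (lie_atlas G).
Local Notation model := ((lie * dual) * (lie * dual))%type.
Local Notation x0 := (coord (ch 1%g) 1%g).
Local Notation dE k u := ('d (chart_rep E k) u).

Lemma is_diff_chart_rep_fst (k g : G) (mu : dual) (xi : lie) (nu : dual) :
  dom (ch k) g ->
  is_diff (coord (ch k) g) (fun y => E ((uncoord (ch k) y, mu), (xi, nu)))
    (fun v => dE k ((coord (ch k) g, mu), (xi, nu)) ((v, 0), (0, 0))).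
Proof.
move=> kg; set a := coord (ch k) g.
have inj : is_diff a (fun y => ((y, mu), (xi, nu)) : model)
    (fun v => ((v, 0), (0, 0))).
  exact: is_diff_pair (is_diff_pair (is_diff_id a) (is_diff_cst mu a))
    (is_diff_cst (xi, nu) a).
have dEu := differentiableP (smooth_at_differentiable
  (chart_rep_smooth E_smooth mu xi nu kg)).
exact: is_diff_comp inj dEu.
Qed.

(** Both sides are the derivative at the identity of [h |-> E ((h * g, mu), (xi, nu))], which does
    not see the chart chosen around [g]. *)
Lemma coTeR_delta_gE (k g : G) (mu : dual) (xi : lie) (nu : dual) :
  dom (ch k) g ->
  coTeR g (delta_g E ((g, mu), (xi, nu))) = covector (fun v =>
    dE k ((coord (ch k) g, mu), (xi, nu)) ((TeR_rep k (coord (ch k) g) v, 0), (0, 0))).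
Proof.
move=> kg; have gg := mem_chart_at ch g.
pose phi (h : G) := E ((h, mu), (xi, nu)).
have [_ e1] := diff_mulr_curve (phi := phi) gg (is_diff_TeR g)
  (is_diff_chart_rep_fst mu xi nu gg).
have [_ e2] := diff_mulr_curve (phi := phi) kg (is_diff_mulr_rep kg)
  (is_diff_chart_rep_fst mu xi nu kg).
apply/colP => i; rewrite /coTeR !mxE delta_gE//.
rewrite (pairing_covector (f := fun v =>
  dE g ((coord (ch g) g, mu), (xi, nu)) ((v, 0), (0, 0)))).
  exact (congr1 (fun h => h (delta_mx 0 i)) (etrans (esym e1) e2)).
move=> r v w; rewrite -linearP; congr (dE _ _ _).
by apply/pair_equal_spec; split; apply/pair_equal_spec; split; rewrite //= scaler0 addr0.
Qed.

Definition field_rep (k : G) (u : model) : model :=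
  let w := vector_of (fun m => dE k u ((0, 0), (0, m))) in
  ((TeR_rep k u.1.1 w, - covector (fun x => dE k u ((0, 0), (x, 0)))),
   (vector_of (fun m => dE k u ((0, m), (0, 0))),
    coad G w u.2.2 - covector (fun v => dE k u ((TeR_rep k u.1.1 v, 0), (0, 0))))).

Lemma field_rep_smooth (k g : G) (mu : dual) (xi : lie) (nu : dual) :
  dom (ch k) g -> smooth_at (field_rep k) ((coord (ch k) g, mu), (xi, nu)).
Proof.
move=> kg; set u : model := ((_, _), _).
have fl : findim lie by exact: findim_mx.
have fd : findim dual by exact: findim_mx.
have fll : findim (lie * lie)%type by exact: findim_prod.
have fld : findim (lie * dual)%type by exact: findim_prod.
have fm : findim model by exact: findim_prod.
have sE : smooth_at (chart_rep E k) u by exact: chart_rep_smooth.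
have s11 : smooth_at (fun v : model => v.1.1) u.
  exact: smooth_at_comp fld (smooth_at_fst _) (smooth_at_fst _).
have s22 : smooth_at (fun v : model => v.2.2) u.
  exact: smooth_at_comp fld (smooth_at_snd _) (smooth_at_snd _).
have sw : smooth_at (fun v => vector_of (fun m => dE k v ((0, 0), (0, m)))) u.
  by apply: smooth_at_vector_of => m; exact: smooth_at_diff.
have sT (w : model -> lie) : smooth_at w u ->
    smooth_at (fun v => TeR_rep k v.1.1 (w v)) u.
  move=> sw0; apply: (smooth_at_dapp (h := fun v : model => (x0, v.1.1))
    (w := fun v => (w v, 0 : lie)) fll).
  - by apply: smooth_at_pair => //; exact: smooth_at_cst.
  - by apply: smooth_at_pair => //; exact: smooth_at_cst.
  - exact: mulrep_smooth.
apply: smooth_at_pair; apply: smooth_at_pair.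
- exact: sT.
- apply: smooth_atN; apply: smooth_at_covector => x; exact: smooth_at_diff.
- by apply: smooth_at_vector_of => m; exact: smooth_at_diff.
- apply: smooth_atD; first exact: smooth_at_coad.
  apply: smooth_atN; apply: smooth_at_covector => v.
  (* The direction [TeR_rep k y.1.1 v] varies with the point, so smoothness of derivatives in fixed
     directions is not enough. *)
  apply: (smooth_at_dapp (h := fun v : model => v)
    (w := fun y : model => ((TeR_rep k y.1.1 v, 0 : dual), (0 : lie, 0 : dual))) fm) => //.
    exact: smooth_at_id.
  apply: smooth_at_pair; last exact: smooth_at_cst.
  by apply: smooth_at_pair; [apply: sT|]; exact: smooth_at_cst.
Qed.

Lemma field_repE (p0 p : TTG G) : dom (ch p0.1.1) p.1.1 ->
  'd (coord (tt_atlas G p0) \o uncoord (tt_atlas G p)) (coord (tt_atlas G p) p)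
    (hamiltonian_field E p) =
  field_rep p0.1.1 (coord (tt_atlas G p0) p).
Proof.
case: p0 p => [[k mu0] [xi0 nu0]] [[g mu] [xi nu]] /= kg.
have gg := mem_chart_at ch g.
set phi := fun y => coord (ch k) (uncoord (ch g) y).
set u : model := ((coord (ch g) g, mu), (xi, nu)).
have dphi : is_diff (u.1.1) phi ('d phi (coord (ch g) g)).
  exact: differentiableP (smooth_at_differentiable
    (smooth_transition (lie_manifold G) gg kg)).
have d11 := is_diff_comp (is_diff_comp (is_diff_fst u) (is_diff_fst u.1)) dphi.
have d12 := is_diff_comp (is_diff_fst u) (is_diff_snd u.1).
have dtr : is_diff u (fun v : model => ((phi v.1.1, v.1.2), v.2))
    (fun v => (('d phi (coord (ch g) g) v.1.1, v.1.2), v.2)).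
  exact: is_diff_pair (is_diff_pair d11 d12) (is_diff_snd u).
(* The change of charts acts on the group coordinate alone, all other factors carrying the identity
   chart. *)
set F := _ \o _; have -> : F = fun v : model => ((phi v.1.1, v.1.2), v.2).
  by apply: funext => -[[? ?] [? ?]].
have [_ ->] := dtr.
rewrite /hamiltonian_field /field_rep /=.
rewrite (TeR_repE _ kg) (coTeR_delta_gE mu xi nu kg)
  (delta_muE E_smooth mu xi nu kg).
by rewrite (delta_nuE E_smooth mu xi nu kg) (delta_xiE E_smooth mu xi nu kg).
Qed.

Lemma hamiltonian_field_smooth :
  smooth_vector_field (A := tt_atlas G) (hamiltonian_field E).
Proof.
move=> p0; apply/smooth_onP; first exact: open_coord.
move=> _ [p pd <-].
have := @field_rep_smooth p0.1.1 p.1.1 p.1.2 p.2.1 p.2.2 pd.1.1.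
have cpE : coord (tt_atlas G p0) p =
  ((coord (ch p0.1.1) p.1.1, p.1.2), (p.2.1, p.2.2)) by [].
rewrite -cpE; apply: smooth_at_near.
apply: filterS (mem_coord pd) => _ [q qd <-].
by rewrite (coordK qd) -field_repE//; case: qd => [[]].
Qed.

End SmoothField.

Theorem proposition6p1 (R : realType) (n : nat) (G : lieGroup R n)
    (E : TTG G -> R^o) (E_smooth : smooth (tt_atlas G) (id_atlas R^o) E) :
  exists X : forall p : TTG G, tangent (tt_atlas G) p,
    smooth_vector_field X
    /\ hamiltonian E X
    /\ (forall Y : forall p : TTG G, tangent (tt_atlas G) p,
          hamiltonian E Y -> forall p, Y p = X p)
    /\ (forall (g : G) (mu : 'cV[R]_n) (xi : 'rV[R]_n) (nu : 'cV[R]_n),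
          let p : TTG G := ((g, mu), (xi, nu)) in
          X p = right_invariant
            ((delta_nu E p,
              - (delta_xi E p + coad G (delta_nu E p) mu)),
             (delta_mu E p + ad G xi (delta_nu E p),
              - (coTeR g (delta_g E p) + coad G xi (delta_xi E p)
                 + coad G xi (coad G (delta_nu E p) mu)))) p)
    /\ (forall (g : G) (mu : 'cV[R]_n) (xi : 'rV[R]_n) (nu : 'cV[R]_n),
          let p : TTG G := ((g, mu), (xi, nu)) in
          X p = ((TeR g (delta_nu E p), - delta_xi E p),
                 (delta_mu E p,
                  coad G (delta_nu E p) nu - coTeR g (delta_g E p))))
    /\ (forall (J : set R) (g : R^o -> G) (mu : R^o -> 'cV[R]_n)
               (xi : R^o -> 'rV[R]_n) (nu : R^o -> 'cV[R]_n),
          open J ->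
          let p := fun t : R^o => ((g t, mu t), (xi t, nu t)) : TTG G in
          integral_curve X J p <->
          forall t : R^o, J t ->
            [/\ has_velocity (lie_atlas G) g t (TeR (g t) (delta_nu E (p t))),
                is_derive t 1 mu (- delta_xi E (p t)),
                is_derive t 1 xi (delta_mu E (p t)) &
                is_derive t 1 nu (coad G (delta_nu E (p t)) (nu t)
                                  - coTeR (g t) (delta_g E (p t)))]).
Proof.
have XH := hamiltonian_field_hamiltonian E_smooth.
exists (hamiltonian_field E); split; first exact: hamiltonian_field_smooth.
split; first exact: XH.
split.
  by move=> Y YH p; apply: tulczyjew_nondegenerate => Z; rewrite YH XH.
split; first by move=> g mu xi nu; exact: hamiltonian_field_right_invariant.
split=> // J g mu xi nu _; exact: hamiltonian_field_integral_curve.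
Qed.
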